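(* Assume $\delta>1$. Let $p^\star:=\frac{(F^\star)^{(-1)}(-m)}{\delta}\mathbf 1_{\{m\le -F^\star(\delta F'(0))\}}+F'(\bar y)\mathbf 1_{\{m>-F^\star(\delta F'(0))\}}$ and, for $p\le p^\star$, $$w^\star(p):=\frac{(-p)^{\frac1{1-\delta}}}{\delta-1}\int_p^{p^\star}\frac{F^\star(\delta x)}{(-x)^{1+\frac1{1-\delta}}}\mathrm dx+m\Big(1-\Big(\frac p{p^\star}\Big)^{\frac1{1-\delta}}\Big)+\Big(\frac p{F'(\bar y)}\Big)^{\frac1{1-\delta}}F^\star(F'(\bar y))\,\mathbf 1_{\{m>-F^\star(\delta F'(0))\}}.$$ Then: (i) if $m\le -F^\star(\delta F'(0))$, then $\bar F(y)=(w^\star)^\star(y)$ for all $y\ge0$; (ii) if $m>-F^\star(\delta F'(0))$, then $\bar F(y)=F(y)\mathbf 1_{[0,\bar y]}(y)+(w^\star)^\star(y)\mathbf 1_{(\bar y,\infty)}(y)$ for all $y\ge0$. In particular, $\bar F$ is continuously differentiable with $\bar F'(0)=\frac{(F^\star)^{(-1)}(-m)}{\delta}\mathbf 1_{\{m\le -F^\star(\delta F'(0))\}}+F'(0)\mathbf 1_{\{m>-F^\star(\delta F'(0))\}}\le0$. Moreover, $\bar F$ is decreasing and strictly concave, and there exist $(\bar c_0,\bar c_1)\in(0,\infty)^2$ such that $\bar c_0(-1-y^\gamma)\le\bar F(y)\le\bar c_1(1-y^\gamma)$ for all $y\ge0$.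
   Context: Constants: $r>0$, $\rho>0$, $\delta:=r/\rho$, $m>0$. ''Increasing'' and ''decreasing'' mean strictly so. The function $u:[0,\infty)\to[0,\infty)$ is increasing, strictly concave, twice continuously differentiable, $u(0)=0$, $\lim_{\pi\to\infty}u'(\pi)=0$, and $c_0(-1+\pi^{1/\gamma})\le u(\pi)\le c_1(1+\pi^{1/\gamma})$ for all $\pi\ge0$, for some $(c_0,c_1)\in(0,\infty)^2$ and some $\gamma>1$. Set $F(y):=-u^{-1}(y)$ for $y\ge0$ and $F^\star(p):=\inf_{y\ge0}\{yp-F(y)\}$ for $p\in\mathbb R$. ($F^\star$ vanishes on $[F'(0),\infty)$ and is negative, increasing and strictly concave on $(-\infty,F'(0))$; $(F^\star)^{(-1)}$ denotes the inverse of the restriction of $F^\star$ to $(-\infty,F'(0))$.) Face-lifted utility: let $\mathcal B_{\mathbb R_+}$ be the set of Borel-measurable maps from $\mathbb R_+$ to $\mathbb R_+$. For $y_0\ge0$ and $p\in\mathcal B_{\mathbb R_+}$ let $y^{y_0,p}$ solve $\dot y^{y_0,p}(t)=r(y^{y_0,p}(t)-p(t))$, $t>0$, $y^{y_0,p}(0)=y_0$, and let $T_0^{y_0,p}:=\inf\{t\ge0:y^{y_0,p}(t)\le0\}$. Then $$\bar F(y_0):=\sup_{p\in\mathcal B_{\mathbb R_+}}\ \sup_{T\in[0,T_0^{y_0,p}]}\Big\{\mathrm e^{-\rho T}F\big(y^{y_0,p}(T)\big)\mathbf 1_{\{T<\infty\}}+\int_0^T\rho\,\mathrm e^{-\rho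 t}\big(-m+F(p(t))\big)\mathrm dt\Big\}.$$ Standing assumption (for $\delta\neq1$): the function $F_{\delta m}(y):=F^\star(\delta F'(y))-\delta yF'(y)+F(y)+m$, $y\ge0$, is decreasing with $\lim_{y\to\infty}F_{\delta m}(y)=-\infty$. Set $\bar y:=\inf\{y\ge0:F_{\delta m}(y)\le0\}\in[0,\infty)$. The concave conjugate of $w^\star$ is $(w^\star)^\star(y):=\inf_{p\le p^\star}\{yp-w^\star(p)\}$, $y\ge0$.
   Formalization: In the definition of F̄, T=∞ is allowed only if e^{-ρt}F(y(t))→0 as t→∞ (equivalently, the sup is over finite T≤T_0); otherwise p=0, T=∞ yields payoff −m for every y_0>0, so F̄≥−m, contradicting the upper growth bound. *)

(* Defs.v *)
(* MathComp-Analysis. *)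
From mathcomp Require Import all_boot all_order all_algebra.
From mathcomp Require Import all_classical all_reals all_analysis.
Import Order.TTheory GRing.Theory Num.Theory.
Import numFieldNormedType.Exports.
Set Implicit Arguments.
Unset Strict Implicit.
Unset Printing Implicit Defensive.
Local Open Scope classical_set_scope.
Local Open Scope ring_scope.

(* Functions on [0, +oo[ are represented by functions f : R -> R of which only
   the values on [0, +oo[ matter.  Differentiability is relative to [0, +oo[:
   it is the usual notion at x > 0 and one-sided at x = 0. *)
Definition diff_quot {R : realType} (f : R -> R) (x z : R) : R :=
  (f z - f x) / (z - x).

Definition derivable_Rp {R : realType} (f : R -> R) (x : R) : Prop :=
  cvg (diff_quot f x z @[z --> within `[0, +oo[ x^']).

Definition deriv_Rp {R : realType} (f : R -> R) (x : R) : R :=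
  lim (diff_quot f x z @[z --> within `[0, +oo[ x^']).

Definition C1_Rp {R : realType} (f : R -> R) : Prop :=
  (forall x, 0 <= x -> derivable_Rp f x) /\
  {within `[0, +oo[, continuous (deriv_Rp f)}.

Definition C2_Rp {R : realType} (f : R -> R) : Prop :=
  C1_Rp f /\ C1_Rp (deriv_Rp f).

Definition increasing_Rp {R : realType} (f : R -> R) : Prop :=
  forall x y, 0 <= x -> x < y -> f x < f y.

Definition decreasing_Rp {R : realType} (f : R -> R) : Prop :=
  forall x y, 0 <= x -> x < y -> f y < f x.

Definition strictly_concave_Rp {R : realType} (f : R -> R) : Prop :=
  forall x y t, 0 <= x -> x < y -> 0 < t -> t < 1 ->
    t * f x + (1 - t) * f y < f (t * x + (1 - t) * y).

Section Model.
Context {R : realType}.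
(* r, rho, m : model constants; u : utility function *)
Variables (r rho m : R) (u : R -> R).

Definition F (y : R) : R := - pinv `[0 : R, +oo[ u y.

Definition F' : R -> R := deriv_Rp F.

Definition Fstar (p : R) : R := inf [set y * p - F y | y in `[0, +oo[].

Definition Fstar_inv : R -> R := pinv `]-oo, F' 0[ Fstar.

Definition delta : R := r / rho.

(* y is the (Caratheodory) solution of y' = r (y - p) on [0, +oo[,
   y 0 = y0.  A control p for which it does not exist, i.e. which is not
   locally integrable, has no trajectory. *)
Definition trajectory (y0 : R) (p y : R -> R) : Prop :=
  forall t, 0 <= t ->
    lebesgue_measure.-integrable `[0, t] (fun s => (r * (y s - p s))%:E) /\
    y t = y0 + \int[lebesgue_measure]_(s in `[0, t]) (r * (y s - p s)).

Definition hitting_time (y : R -> R) : \bar R :=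
  ereal_inf [set t%:E | t in [set t | 0 <= t /\ y t <= 0]].

Definition terminal_value (y : R -> R) (t : R) : R := expR (- rho * t) * F (y t).

Definition running_value (p : R -> R) (t : R) : R :=
  rho * expR (- rho * t) * (- m + F (p t)).

Definition payoff (p y : R -> R) (T : \bar R) : \bar R :=
  ((if T is t%:E then (terminal_value y t)%:E else 0) +
   \int[lebesgue_measure]_(t in [set t : R | (0 <= t)%R /\ t%:E <= T])
     (running_value p t)%:E)%E.

(* T = +oo is allowed only if the discounted terminal value vanishes in the
   limit, which is what dropping the terminal term at T = +oo presupposes.
   Otherwise p = 0 and T = +oo (with y t = y0 * e^(rt)) would have payoff - m
   whatever y0, so that Fbar >= - m.  Since then payoff p y +oo is the limit of
   payoff p y T as T -> +oo, the supremum is that over the finite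
   T <= hitting_time y. *)
Definition admissible (y0 : R) (p y : R -> R) (T : \bar R) : Prop :=
  [/\ measurable_fun `[0 : R, +oo[ p,
      forall t, 0 <= t -> 0 <= p t,
      trajectory y0 p y,
      (0 <= T <= hitting_time y)%E &
      T = +oo%E -> terminal_value y t @[t --> +oo] --> 0].

Definition Fbar (y0 : R) : \bar R :=
  ereal_sup [set J | exists p y T,
    admissible y0 p y T /\ J = payoff p y T].

Definition Fdm (y : R) : R :=
  Fstar (delta * F' y) - delta * y * F' y + F y + m.

Definition ybar : R := inf [set y | 0 <= y /\ Fdm y <= 0].

(* the condition distinguishing the two cases: m <= - F^*(delta F'(0)) *)
Definition small_m : bool := m <= - Fstar (delta * F' 0).

Definition pstar : R :=
  Fstar_inv (- m) / delta * small_m%:R + F' ybar * (~~ small_m)%:R.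

Definition wstar (p : R) : R :=
  let a := (1 - delta)^-1 in
  (- p) `^ a / (delta - 1) *
    \int[lebesgue_measure]_(x in `[p, pstar])
      (Fstar (delta * x) / (- x) `^ (1 + a))
  + m * (1 - (p / pstar) `^ a)
  + (p / F' ybar) `^ a * Fstar (F' ybar) * (~~ small_m)%:R.

Definition wstar_conj (y : R) : \bar R :=
  ereal_inf [set (y * p - wstar p)%:E | p in `]-oo, pstar]].

End Model.

(* Main.v *)
Require Import Defs.
From mathcomp Require Import all_boot all_order all_algebra.
From mathcomp Require Import all_classical all_reals all_analysis.
From mathcomp Require Import measurable_realfun ring lra.
Import Order.TTheory GRing.Theory Num.Theory.
Import numFieldNormedType.Exports.
Set Implicit Arguments.
Unset Strict Implicit.
Unset Printing Implicit Defensive.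
Local Open Scope classical_set_scope.
Local Open Scope ring_scope.

(** The dynamics is linear in the state and the reward is concave in the control
    and in the final state, so the problem is solved by convex duality.

    Fix q0 < 0 and let q(t) = q0 exp(- (r - rho) t), a costate. Fenchel's
    inequality F p <= delta q p - Fstar (delta q), integrated against the discount
    factor, bounds the running reward by a deterministic integral plus a multiple
    of the integral of r exp(- r t) p(t); by linearity of the dynamics the latter
    depends on the initial and final states only. Since the final reward is at
    most q(T) y(T) - Fstar (q(T)), the final state cancels (weak_duality_finite).

    The deterministic integral is evaluated with the solution w of the linear
    equation (delta - 1) p w' + w = Fstar (delta p) + m, which is the Legendre
    transform of the Hamilton-Jacobi-Bellman equation and whose solution with value
    Fstar at pstar is wstar (dual_solution_exists, wstarE). What remains is the
    weighted difference gap of Fstar and w. Its derivative at p is a negative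
    factor times an expression equal to - Fdm (Fstar' p) for p <= F' 0 and to
    - Fstar (delta p) - m for p >= F' 0; the monotonicity of Fdm and of Fstar makes
    gap decrease up to pstar, where it vanishes, and increase afterwards (gap_ge0,
    gap_incr). Every payoff is therefore at most q0 y0 - w q0 if q0 <= pstar, and
    at most q0 y0 - Fstar q0 otherwise (weak_duality).

    The bounds are attained. For q0 <= pstar, the state w'(q(t)) with control
    Fstar'(delta q(t)) is an explicit trajectory which turns Fenchel's inequality
    into an equality; it starts from w'(q0) and is stopped when q reaches pstar,
    i.e. when the state reaches ybar (attainment). Below ybar one stops at once.
    As w' decreases from +oo to ybar on ]-oo, pstar], all states are covered and
    both formulas for Fbar follow.

    Weak duality also says that the optimal costate is a supergradient of Fbar. It
    is a decreasing function of the state onto an interval, hence continuous, which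
    yields the C1 regularity and strict concavity. Finally Fbar >= F by immediate
    stopping, while w >= Fstar (delta .) gives Fbar y <= F (y / delta) for large y,
    and both sides inherit the power growth of F from that of u. *)

(** * Differentiation and integration of pointwise expressions *)

Section Calculus.
Context {R : realType}.
Implicit Types (f g : R -> R) (x a b : R).

Lemma isder_add f g x a b : is_derive x (1:R) f a -> is_derive x (1:R) g b ->
  is_derive x (1:R) (fun z => f z + g z) (a + b).
Proof. by move=> df dg; exact: is_deriveD. Qed.

Lemma isder_opp f x a : is_derive x (1:R) f a -> is_derive x (1:R) (fun z => - f z) (- a).
Proof. by move=> df; exact: is_deriveN. Qed.

Lemma isder_mul f g x a b : is_derive x (1:R) f a -> is_derive x (1:R) g b ->
  is_derive x (1:R) (fun z => f z * g z) (f x * b + g x * a).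
Proof. by move=> df dg; exact: is_deriveM. Qed.

Lemma isder_comp f g x a b : is_derive x (1:R) f a -> is_derive (f x) (1:R) g b ->
  is_derive x (1:R) (fun z => g (f z)) (b * a).
Proof. by move=> df dg; exact: (@is_derive1_comp _ g f x b a dg df). Qed.

Lemma isder_cst x (k : R) : is_derive x (1:R) (fun=> k : R) 0.
Proof. exact: is_derive_cst. Qed.

Lemma isder_id (x : R) : is_derive x (1:R) (fun z : R => z) 1.
Proof. exact: is_derive_id. Qed.

Lemma isder_scale f x a k : is_derive x (1:R) f a -> is_derive x (1:R) (fun z => k * f z) (k * a).
Proof. by move=> df; exact: (is_deriveZ _ df). Qed.

Lemma isder_eq f x a b : is_derive x (1:R) f a -> a = b -> is_derive x (1:R) f b.
Proof. by move=> df <-. Qed.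

Lemma isder_ext f g x a : is_derive x (1:R) f a -> f =1 g -> is_derive x (1:R) g a.
Proof. by move=> df /funext <-. Qed.

Lemma isder_near f g x a : is_derive x (1:R) f a -> (\near x, f x = g x) -> is_derive x (1:R) g a.
Proof. by move=> df fg; exact: near_eq_is_derive fg df. Qed.

Lemma isder_cont f x a : is_derive x (1:R) f a -> {for x, continuous f}.
Proof.
by move=> df; apply/differentiable_continuous/derivable1_diffP; exact: ex_derive.
Qed.

Lemma isder_powRN x (a : R) : x < 0 ->
  is_derive x (1:R) (fun z => (- z) `^ a) (- a * (- x) `^ (a - 1)).
Proof.
move=> x0; have x0' : 0 < - x by rewrite oppr_gt0.
have d := is_derive1_powR a x0'.
apply: isder_eq; first exact: (isder_comp (isder_opp (isder_id x)) d).
by rewrite mulrN1 mulNr.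
Qed.

Lemma ler_powR_nneg (c a b : R) : 0 <= c -> 0 <= a -> a <= b -> a `^ c <= b `^ c.
Proof.
by move=> c0 a0 ab; apply: ge0_ler_powR => //; rewrite nnegrE// (le_trans a0).
Qed.

Lemma is_derive_MVT f (f' : R -> R) a b : a < b ->
  (forall x, a <= x <= b -> is_derive x (1:R) f (f' x)) ->
  exists2 c, a < c < b & f b - f a = f' c * (b - a).
Proof.
move=> ab df; have [x||c cab e] := @MVT R f f' a b ab.
- by rewrite in_itv/= => /andP[/ltW ax /ltW xb]; apply: df; rewrite ax.
- apply: continuous_in_subspaceT => x; rewrite inE /= in_itv/= => /df; exact: isder_cont.
- by exists c; [move: cab; rewrite in_itv|].
Qed.

Lemma is_derive_ge0_le f (f' : R -> R) a b : a <= b ->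
  (forall x, a <= x <= b -> is_derive x (1:R) f (f' x)) ->
  (forall x, a < x < b -> 0 <= f' x) -> f a <= f b.
Proof.
rewrite le_eqVlt => /orP[/eqP <-//|ab df f'0].
have [c cab e] := is_derive_MVT ab df.
by rewrite -subr_ge0 e mulr_ge0 ?f'0 ?subr_ge0// ltW.
Qed.

Lemma is_derive_gt0_lt f (f' : R -> R) a b : a < b ->
  (forall x, a <= x <= b -> is_derive x (1:R) f (f' x)) ->
  (forall x, a < x < b -> 0 < f' x) -> f a < f b.
Proof.
move=> ab df f'0; have [c cab e] := is_derive_MVT ab df.
by rewrite -subr_gt0 e mulr_gt0 ?subr_gt0// f'0.
Qed.

Lemma FTC2 f g a b : a <= b -> continuous f ->
  (forall x, is_derive x (1:R) g (f x)) ->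
  (\int[lebesgue_measure]_(x in `[a, b]) (f x)%:E = (g b - g a)%:E)%E.
Proof.
rewrite le_eqVlt => /orP[/eqP <- _ _|ab cf dg].
  by rewrite set_itv1 integral_set1 subrr.
have cg : continuous g by move=> x; exact: isder_cont.
rewrite (@continuous_FTC2 _ f g)//.
- exact: continuous_subspaceT.
- split=> [x _| |]; [exact: ex_derive|exact/cvg_at_right_filter/cg|exact/cvg_at_left_filter/cg].
- by move=> x _; rewrite derive1E; exact: derive_val.
Qed.

Lemma continuous_integrable f a b : continuous f ->
  lebesgue_measure.-integrable `[a, b] (EFin \o f).
Proof.
move=> cf; apply: continuous_compact_integrable; first exact: segment_compact.
exact: continuous_subspaceT.
Qed.

Lemma IVT_pointwise f a b v : a <= b -> (forall x, a <= x <= b -> {for x, continuous f}) ->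
  f a <= v <= f b \/ f b <= v <= f a -> exists2 c, a <= c <= b & f c = v.
Proof.
move=> ab cf fv.
have cf' : {within `[a, b], continuous f}.
  by apply: continuous_in_subspaceT => x; rewrite inE/= in_itv/= => /cf.
have [|c] := @IVT R f a b v ab cf'.
  by rewrite ge_min le_max; case: fv => /andP[-> ->]; rewrite ?orbT.
by rewrite in_itv/= => cab <-; exists c.
Qed.

End Calculus.

(** * Supergradients and one-sided derivatives *)

Section Supergradient.
Context {R : realType}.
Implicit Types (f g : R -> R) (x a b : R).

(** A jump of a monotone function would skip the values inside the jump. *)
Lemma nonincreasing_continuous g :
  (forall x y, x <= y -> g y <= g x) ->
  (forall x y v, x < y -> g y < v < g x -> exists z, g z = v) ->
  continuous g.
Proof.
move=> gd gs x; apply/cvgrPdist_le => e e0.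
have [d d0 hd] : exists2 d, 0 < d & forall y, x <= y < x + d -> g x - e <= g y.
  have [H|] := pselect (forall y, x <= y -> g x - e <= g y).
    by exists 1 => // y /andP[/H].
  move=> /existsNP[y /not_implyP[xy /negP]]; rewrite -ltNge => gy.
  have xy' : x < y.
    by rewrite lt_neqAle xy andbT; apply: contraTneq gy => <-; rewrite -leNgt gerBl ltW.
  have [|z gz] := gs x y (g x - e) xy'; first by rewrite gy gtrBl.
  have xz : x < z.
    rewrite ltNge; apply/negP => /gd; rewrite gz lerBrDr gerDl => /(lt_le_trans e0).
    by rewrite ltxx.
  exists (z - x); rewrite ?subr_gt0// => t; rewrite addrC subrK => /andP[_ /ltW /gd].
  by rewrite gz.
have [c c0 hc] : exists2 d, 0 < d & forall y, x - d < y <= x -> g y <= g x + e.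
  have [H|] := pselect (forall y, y <= x -> g y <= g x + e).
    by exists 1 => // y /andP[_ /H].
  move=> /existsNP[y /not_implyP[xy /negP]]; rewrite -ltNge => gy.
  have xy' : y < x.
    by rewrite lt_neqAle xy andbT; apply: contraTneq gy => ->; rewrite -leNgt lerDl ltW.
  have [|z gz] := gs y x (g x + e) xy'; first by rewrite gy ltrDl e0.
  have xz : z < x.
    rewrite ltNge; apply/negP => /gd; rewrite gz gerDl => /(lt_le_trans e0).
    by rewrite ltxx.
  exists (x - z); rewrite ?subr_gt0// => t; rewrite subKr => /andP[/ltW /gd + _].
  by rewrite gz.
near=> y; rewrite ler_distlC; have [xy|yx] := leP x y.
  have -> : g x - e <= g y.
    apply: hd; rewrite xy/=; near: y; apply: lt_nbhsl; by rewrite ltrDl.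
  by rewrite (le_trans (gd _ _ xy))// lerDl ltW.
have -> : g y <= g x + e.
  apply: hc; rewrite (ltW yx) andbT; near: y; apply: lt_nbhsr; by rewrite gtrBl.
by rewrite andbT (le_trans _ (gd _ _ (ltW yx)))// gerBl ltW.
Unshelve. all: by end_near. Qed.

(** The two supergradient inequalities, at x and at z, squeeze the slope between
    g x and g z; a continuous choice of supergradients is thus the derivative. *)
Lemma supergradient_slope f g x z : z != x ->
  f z <= f x + g x * (z - x) -> f x <= f z + g z * (x - z) ->
  `|diff_quot f x z - g x| <= `|g z - g x|.
Proof.
move=> zx h1 h2; rewrite /diff_quot.
have e : f z - f x = ((f z - f x) / (z - x)) * (z - x).
  by rewrite mulfVK// subr_eq0.
set k := (f z - f x) / (z - x) in e *.
have {}h1 : k * (z - x) <= g x * (z - x) by rewrite -e; lra.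
have {}h2 : g z * (z - x) <= k * (z - x) by rewrite -e; lra.
have [zx'|xz|/eqP] := ltgtP z x; last by rewrite (negbTE zx).
- have k1 : g x <= k by rewrite -(ler_nM2r (_ : z - x < 0))// subr_lt0.
  have k2 : k <= g z by rewrite -(ler_nM2r (_ : z - x < 0))// subr_lt0.
  by rewrite !ger0_norm ?subr_ge0 ?lerD2r// (le_trans k1).
- have k1 : k <= g x by rewrite -(ler_pM2r (_ : 0 < z - x))// subr_gt0.
  have k2 : g z <= k by rewrite -(ler_pM2r (_ : 0 < z - x))// subr_gt0.
  by rewrite !ler0_norm ?subr_le0 ?lerN2 ?lerD2r// (le_trans k2).
Qed.

Lemma supergradient_diff_quot f g x (D : set R) :
  (forall z, D z -> f z <= f x + g x * (z - x) /\ f x <= f z + g z * (x - z)) ->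
  {for x, continuous g} ->
  diff_quot f x z @[z --> within D x^'] --> g x.
Proof.
move=> fg cg; apply/cvgrPdist_le => e e0; rewrite near_withinE/= near_withinE/=.
move/cvgrPdist_le : cg => /(_ e e0); apply: filterS => z gz zx /fg[h1 h2].
by rewrite distrC (le_trans (supergradient_slope _ h1 h2))// distrC.
Qed.

Lemma supergradient_is_derive f g x :
  (forall z, f z <= f x + g x * (z - x) /\ f x <= f z + g z * (x - z)) ->
  {for x, continuous g} -> is_derive x (1:R) f (g x).
Proof.
move=> fg cg.
have H : h^-1 *: (f (h *: (1:R) + x) - f x) @[h --> 0^'] --> g x.
  apply/cvgrPdist_le => e e0; rewrite near_withinE/=.
  have c0 : {for 0, continuous (fun h : R => g (h *: (1:R) + x))}.
    apply: continuous_comp; last by rewrite scale0r add0r.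
    have d : is_derive (0:R) (1:R) (fun h : R => h + x) (1 + 0).
      exact: isder_add.
    apply: (isder_cont (a := 1 + 0)); apply: (isder_ext d) => z.
    by rewrite -[z *: 1]/(z * 1) mulr1.
  move/cvgrPdist_le : c0 => /(_ e e0); apply: filterS => h; rewrite scale0r add0r => gz h0.
  have [h1 h2] := fg (h *: (1:R) + x).
  have hx : h *: (1:R) + x != x by rewrite -subr_eq0 addrK scaler_eq0 oner_eq0 orbF.
  have := supergradient_slope hx h1 h2.
  rewrite /diff_quot addrK -[h *: 1]/(h * 1) mulr1 mulrC -[_^-1 * _]/(_^-1 *: _) => le.
  by rewrite distrC (le_trans le)// distrC; move: gz; rewrite -[h *: 1]/(h * 1) mulr1.
apply: DeriveDef; first by apply/cvg_ex; exists (g x).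
exact: cvg_lim H.
Qed.

End Supergradient.

Section HalfLine.
Context {R : realType}.
Implicit Types (f g : R -> R) (x a b : R).

Lemma Rp_dnbhs_proper x : 0 <= x -> ProperFilter (within `[0 : R, +oo[ x^').
Proof.
move=> x0; apply: Build_ProperFilter_ex => P.
rewrite /within/= => /nbhs_ballP[e /= e0 he]; exists (x + e / 2); apply: he => /=.
- by rewrite /ball/= opprD addrA subrr add0r normrN gtr0_norm ?divr_gt0// ltr_pdivrMr// ltr_pMr// ltr1n.
- by rewrite -subr_eq0 addrC addKr gt_eqF// divr_gt0.
- by rewrite in_itv/= andbT addr_ge0// ltW// divr_gt0.
Qed.

Lemma deriv_RpE f x l : 0 <= x ->
  diff_quot f x z @[z --> within `[0, +oo[ x^'] --> l -> derivable_Rp f x /\ deriv_Rp f x = l.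
Proof.
move=> x0 fl; split; first by apply/cvg_ex; exists l.
by have := Rp_dnbhs_proper x0 => ?; exact: cvg_lim fl.
Qed.

Lemma supergradient_Rp f g x : 0 <= x ->
  (forall z, 0 <= z -> f z <= f x + g x * (z - x) /\ f x <= f z + g z * (x - z)) ->
  {for x, continuous (fun z : R => g (Num.max z 0))} -> derivable_Rp f x /\ deriv_Rp f x = g x.
Proof.
move=> x0 fg cg; apply: deriv_RpE => //.
have -> : g x = g (Num.max x 0) by congr g; rewrite max_l.
apply: (@supergradient_diff_quot _ f (fun z : R => g (Num.max z 0))) => //=.
by move=> z; rewrite in_itv/= andbT => z0; rewrite !max_l//; exact: fg.
Qed.

Lemma continuous_max0 : continuous (fun z : R => Num.max z 0).
Proof. by move=> z; apply: continuous_max; [exact: cvg_id|exact: cvg_cst]. Qed.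

Lemma max0_ge0 (z : R) : 0 <= Num.max z 0.
Proof. by rewrite le_max lexx orbT. Qed.

(** Composing with the retraction of the line onto [0, +oo[ turns one-sided
    statements at 0 into two-sided ones. *)
Lemma continuous_Rp f : {within `[0, +oo[, continuous f} <->
  continuous (fun z : R => f (Num.max z 0)).
Proof.
split=> [cf x|cf].
- have cm := continuous_max0.
  move/subspace_continuousP : cf => /(_ (Num.max x 0)).
  rewrite /= in_itv/= andbT le_max lexx orbT => /(_ isT) cf.
  apply: (@cvg_comp _ _ _ (fun z : R => Num.max z 0) f _ (within `[0, +oo[ (nbhs (Num.max x 0)))) => //.
  move=> P /(cm x) H.
  have {}H : \forall z \near x, `[0, +oo[%classic (Num.max z 0) -> P (Num.max z 0) by exact: H.
  have F : Filter (nbhs x) by exact: nbhs_filter.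
  apply: (@filterS _ (nbhs x) F _ _ _ H) => z /=; apply.
  by rewrite in_itv/= andbT le_max lexx orbT.
- apply/subspace_continuousP => x /=; rewrite in_itv/= andbT => x0.
  have := cf x; rewrite /continuous_at max_l// => /cvgrPdist_le H.
  apply/cvgrPdist_le => e /H; rewrite near_withinE; apply: filterS => z + z0.
  by rewrite max_l//; move: z0; rewrite /= in_itv/= andbT.
Qed.

End HalfLine.

(** * Antiderivatives and absolutely continuous states *)

Section Integration.
Context {R : realType}.
Notation mu := (@lebesgue_measure R).
Implicit Types (f g : R -> R) (x a b : R).

Lemma Rintegral_split f a b c : a <= b <= c ->
  mu.-integrable `[a, c] (EFin \o f) ->
  \int[mu]_(x in `[a, c]) f x =
  \int[mu]_(x in `[a, b]) f x + \int[mu]_(x in `[b, c]) f x.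
Proof.
move=> /andP[ab bc] fi.
have := @Rintegral_itvB R f (BLeft a) (BRight c) b fi.
rewrite !bnd_simp => /(_ ab bc) /eqP; rewrite subr_eq => /eqP ->.
rewrite addrC Rintegral_itv_obnd_cbnd//.
by apply: integrableS fi => //; apply: subset_itv; rewrite bnd_simp.
Qed.

(** The primitive is extended beyond c, so that it is differentiable at c itself
    and no one-sided derivative is needed there. *)
Lemma antiderivative_tail (k : R -> R) c : c < 0 ->
  (forall x, x < 0 -> {for x, continuous k}) ->
  exists K : R -> R, (forall x, x < 0 -> is_derive x (1:R) K (- k x)) /\
    (forall p, p <= c -> \int[mu]_(x in `[p, c]) k x = K p).
Proof.
move=> c0 ck.
have ki a b : b < 0 -> mu.-integrable `[a, b] (EFin \o k).
  move=> b0; apply: continuous_compact_integrable; first exact: segment_compact.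
  apply: continuous_in_subspaceT => x; rewrite inE /= in_itv/= => /andP[_ xb].
  by apply: ck; rewrite (le_lt_trans xb).
exists (fun p => if p <= c then \int[mu]_(x in `[p, c]) k x
                 else - \int[mu]_(x in `[c, p]) k x).
split=> [x x0|p ->//].
pose b := Num.min x c - 1.
have bx : b < x by rewrite ltrBlDr gt_min ltrDl ltr01.
have bc : b < c by rewrite ltrBlDr gt_min orbC ltrDl ltr01.
have xx2 : x < x / 2 by lra.
have x20 : x / 2 < 0 by lra.
have [d1 d2] := continuous_FTC1_closed xx2 (ki b _ x20) bx (ck x x0).
rewrite derive1E in d2.
have d : is_derive x (1:R) (fun z => \int[mu]_(t in `[b, z]) k t) (k x).
  exact: DeriveDef.
have := isder_add (isder_cst x (\int[mu]_(t in `[b, c]) k t)) (isder_opp d).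
rewrite add0r => d'; apply: (isder_near d').
near=> z.
have bz : b <= z by apply: ltW; near: z; exact: lt_nbhsr.
have z0 : z < 0 by near: z; exact: lt_nbhsl.
case: ifPn => zc.
  rewrite (@Rintegral_split k b z c) ?bz ?zc//; last exact: ki.
  by rewrite addrC addKr.
rewrite -ltNge in zc.
rewrite (@Rintegral_split k b c z) ?(ltW bc) ?(ltW zc)//; last exact: ki.
by rewrite opprD addrA subrr add0r.
Unshelve. all: by end_near. Qed.

(** Summed over n equal steps, the increments are at most T / n (N T - N 0). *)
Lemma quadratic_increments_constant (Phi N : R -> R) T : 0 <= T ->
  (forall s t, 0 <= s -> s <= t -> t <= T ->
    `|Phi t - Phi s| <= (t - s) * (N t - N s)) -> Phi T = Phi 0.
Proof.
move=> T0 H; apply/eqP; rewrite -subr_eq0 -normr_le0; apply/ler_addgt0Pr => e e0.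
rewrite add0r; set C := T * (N T - N 0).
have [n nC] : exists n : nat, C / e < n.+1%:R.
  exists (Num.truncn (C / e)); exact: truncnS_gt.
have n0 : 0 < n.+1%:R :> R by rewrite ltr0Sn.
have h0 : 0 <= T / n.+1%:R by rewrite divr_ge0// ltW.
have step i : (i <= n.+1)%N ->
    `|Phi (i%:R * (T / n.+1%:R)) - Phi 0| <= (T / n.+1%:R) * (N (i%:R * (T / n.+1%:R)) - N 0).
  elim: i => [_|i IH /[dup] iln /ltnW /IH {}IH].
    by rewrite mul0r !subrr normr0 mulr0.
  have := H (i%:R * (T / n.+1%:R)) (i.+1%:R * (T / n.+1%:R)).
  rewrite mulr_ge0// => /(_ isT); rewrite ler_wpM2r ?ler_nat// => /(_ isT).
  have -> : i.+1%:R * (T / n.+1%:R) <= T.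
    by rewrite mulrCA ler_piMr// ler_pdivrMr// mul1r ler_nat.
  move=> /(_ isT); rewrite -mulrBl -natrB// subSnn mul1r => {}H.
  rewrite (le_trans (ler_distD (Phi (i%:R * (T / n.+1%:R))) _ _))//.
  by rewrite (le_trans (lerD H IH))// -mulrDr addrA subrK.
have := step n.+1 (leqnn _).
rewrite mulrCA divff ?gt_eqF// mulr1 => /le_trans; apply.
rewrite mulrAC -/C ler_pdivrMr// mulrC -ler_pdivrMr//; exact: ltW.
Qed.

Lemma integrable_scale f k a b : mu.-integrable `[a, b] (EFin \o f) ->
  mu.-integrable `[a, b] (EFin \o (fun x => k * f x)).
Proof.
by move=> hi; exact: (@integrableZl _ _ R mu `[a, b] (measurable_itv _) k _ hi).
Qed.

Lemma integrable_sub f g a b : mu.-integrable `[a, b] (EFin \o f) ->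
  mu.-integrable `[a, b] (EFin \o g) ->
  mu.-integrable `[a, b] (EFin \o (fun x => f x - g x)).
Proof.
by move=> hf hg; exact: (@integrableB _ _ R mu `[a, b] (measurable_itv _) _ _ hf hg).
Qed.

Lemma integrable_add f g a b : mu.-integrable `[a, b] (EFin \o f) ->
  mu.-integrable `[a, b] (EFin \o g) ->
  mu.-integrable `[a, b] (EFin \o (fun x => f x + g x)).
Proof.
by move=> hf hg; exact: (@integrableD _ _ R mu `[a, b] (measurable_itv _) _ _ hf hg).
Qed.

Lemma caratheodory_continuous (f : R -> R) (y : R -> R) (y0 b : R) : 0 <= b ->
  (forall t, 0 <= t -> mu.-integrable `[0, t] (EFin \o f) /\
    y t = y0 + \int[mu]_(s in `[0, t]) f s) ->
  {within `[0, b], continuous y}.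
Proof.
move=> b0 traj; have [fi _] := traj b b0.
have /= c := parameterized_integral_continuous b0 fi.
apply/subspace_continuousP => x xb.
move/subspace_continuousP : c => /(_ x xb) c.
apply: (@cvg_trans _ ((fun x => y0 + parameterized_integral mu 0 x f) @ within `[0, b] (nbhs x))).
  apply: near_eq_cvg; rewrite near_withinE; apply: nearW => z.
  by rewrite /= in_itv/= => /andP[/traj[_ h] _]; exact: esym h.
have yx : y x = y0 + parameterized_integral mu 0 x f.
  by move: xb; rewrite /= in_itv/= => /andP[/traj[_ h] _]; exact: h.
have H : (fun x => y0 + parameterized_integral mu 0 x f) @ within `[0, b] (nbhs x) -->
  y0 + parameterized_integral mu 0 x f := cvgD (cvg_cst y0) c.
by move: H; rewrite -yx; apply.
Qed.

(** As p is only measurable, y is merely absolutely continuous, and the derivative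
    of exp(- rr t) y(t) need not exist everywhere. The claim says that Phi below is
    constant. The increment of Phi over [s, t] is the integral of
    rr e (y - y s) - (e - e t) f with e = exp(- rr .) and f = y'; both terms are
    at most rr (t - s) times the integral of |f|, so the increments are of second
    order. *)
Lemma discounted_ode (rr : R) (y p : R -> R) (y0 T : R) : 0 < rr -> 0 <= T ->
  (forall t, 0 <= t -> mu.-integrable `[0, t] (fun s => (rr * (y s - p s))%:E) /\
    y t = y0 + \int[mu]_(s in `[0, t]) (rr * (y s - p s))) ->
  mu.-integrable `[0, T] (fun s => (rr * expR (- rr * s) * p s)%:E) /\
  \int[mu]_(s in `[0, T]) (rr * expR (- rr * s) * p s) = y0 - expR (- rr * T) * y T.
Proof.
move=> rr0 T0 traj.
pose f s := rr * (y s - p s).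
pose e s : R := expR (- rr * s).
have fi a b : 0 <= a -> mu.-integrable `[a, b] (EFin \o f).
  move=> a0; have [ab|ba] := leP a b; last by rewrite set_itv_ge ?bnd_simp -?ltNge//; exact: integrable_set0.
  have [] := traj b (le_trans a0 ab); move=> fi _.
  by apply: integrableS fi => //; apply: subset_itv; rewrite bnd_simp.
have yE s t : 0 <= s -> s <= t -> y t = y s + \int[mu]_(x in `[s, t]) f x.
  move=> s0 st; have [_ ->] := traj t (le_trans s0 st); have [_ ->] := traj s s0.
  by rewrite (@Rintegral_split f 0 s t) ?s0 ?st ?addrA//; exact: fi.
have ec : continuous e.
  have d x : is_derive x (1:R) e (expR (- rr * x) * (- rr * 1)).
    exact: (isder_comp (isder_scale (- rr) (isder_id x)) (is_derive_expR _)).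
  by move=> x; exact: (isder_cont (d x)).
have ede s t : s <= t -> \int[mu]_(x in `[s, t]) (rr * e x) = e s - e t.
  move=> st.
  have d x : is_derive x (1:R) (fun x => - e x) (rr * e x).
    apply: (isder_eq (isder_opp (isder_comp (isder_scale (- rr) (isder_id x)) (is_derive_expR _)))).
    by rewrite mulr1 mulrN opprK mulrC.
  have c : continuous (fun x => rr * e x).
    by move=> x; apply: cvgM; [exact: cvg_cst|exact: ec].
  by rewrite /Rintegral (FTC2 st c d)/= opprK addrC.
have yi a b : 0 <= a -> mu.-integrable `[a, b] (EFin \o y).
  move=> a0; have [ab|ba] := leP a b; last by rewrite set_itv_ge ?bnd_simp -?ltNge//; exact: integrable_set0.
  have b0 := le_trans a0 ab.
  have : mu.-integrable `[0, b] (EFin \o y).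
    apply: continuous_compact_integrable; first exact: segment_compact.
    exact: caratheodory_continuous b0 traj.
  by apply: integrableS => //; apply: subset_itv; rewrite bnd_simp.
have ei (h : R -> R) a b : mu.-integrable `[a, b] (EFin \o h) ->
    mu.-integrable `[a, b] (EFin \o (fun x => e x * h x)).
  move=> hi; have := @integrableMr _ _ R mu `[a, b] (measurable_itv _) e (EFin \o h).
  apply => //; first by apply: measurable_funTS; exact: continuous_measurable_fun.
  exists (e a); split; first exact: num_real.
  move=> M /= /ltW aM x /=; rewrite in_itv/= => /andP[ax _].
  rewrite ger0_norm ?expR_ge0// (le_trans _ aM)// ler_expR.
  by rewrite !mulNr lerN2 ler_wpM2l// ltW.
pose g s := rr * e s * p s.
have gE : g = (fun x => rr * (e x * y x) - e x * f x).
  by apply/funext => x; rewrite /g /f; ring.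
have gi a b : 0 <= a -> mu.-integrable `[a, b] (EFin \o g).
  move=> a0; rewrite gE; apply: integrable_sub; last by apply: ei; exact: fi.
  by apply: integrable_scale; apply: ei; exact: yi.
split; first exact: gi.
pose N (t : R) := (2 * rr) * \int[mu]_(x in `[0, t]) `|f x|.
pose Phi t := \int[mu]_(x in `[0, t]) g x + e t * y t.
suff : Phi T = Phi 0.
  rewrite /Phi set_itv1 Rintegral_set1 add0r /e mulr0 expR0 mul1r.
  have [_ ->] := traj 0 (lexx 0); rewrite set_itv1 Rintegral_set1 addr0.
  by move=> <-; rewrite addrK.
apply: (@quadratic_increments_constant Phi N) => // s t s0 st tT.
have t0 := le_trans s0 st.
have fni a b : 0 <= a -> mu.-integrable `[a, b] (EFin \o (fun x => `|f x|)).
  by move=> a0; apply: (integrable_norm (fi a b a0)).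
pose M := \int[mu]_(x in `[s, t]) `|f x|.
have -> : N t - N s = 2 * rr * M.
  rewrite /N (@Rintegral_split _ 0 s t) ?s0 ?st//; last exact: fni.
  by rewrite mulrDr addrAC subrr add0r.
have fst := fi s t s0; have gst := gi s t s0.
have Mf : `|\int[mu]_(x in `[s, t]) f x| <= M by exact: le_normr_Rintegral.
have e1 x : 0 <= x -> 0 <= e x <= 1.
  by move=> x0; rewrite /e expR_ge0/= expR_le1 mulNr oppr_le0 mulr_ge0// ltW.
have ede2 x : s <= x <= t -> `|e x - e t| <= rr * (t - s).
  move=> /andP[sx xt]; have x0 := le_trans s0 sx.
  rewrite ger0_norm ?subr_ge0; last by rewrite ler_expR !mulNr lerN2 ler_wpM2l// ltW.
  have -> : e x - e t = e x * (1 - expR (- (rr * (t - x)))).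
    by rewrite mulrBr mulr1 -expRD; congr (_ - expR _); ring.
  have /andP[ex0 ex1] := e1 x x0.
  have h : 1 - expR (- (rr * (t - x))) <= rr * (t - x).
    by have := expR_ge1Dx (- (rr * (t - x))); lra.
  have h' : rr * (t - x) <= rr * (t - s) by rewrite ler_wpM2l ?lerD2l ?lerN2// ltW.
  apply: (le_trans _ h'); apply: (le_trans _ h); apply: ler_piMl => //.
  by rewrite subr_ge0 expR_le1 oppr_le0 mulr_ge0 ?subr_ge0// ltW.
have eic : mu.-integrable `[s, t] (EFin \o (fun x => rr * e x)).
  by apply: integrable_scale; exact: continuous_integrable.
pose k x := (g x + e t * f x) - y s * (rr * e x).
have kE x : k x = rr * (e x * (y x - y s)) - (e x - e t) * f x.
  by rewrite /k /g /f; ring.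
have gf : mu.-integrable `[s, t] (EFin \o (fun x => g x + e t * f x)).
  by apply: integrable_add; [exact: gi|exact: integrable_scale].
have eys : mu.-integrable `[s, t] (EFin \o (fun x => y s * (rr * e x))).
  exact: integrable_scale.
have ki : mu.-integrable `[s, t] (EFin \o k) by exact: integrable_sub.
have incr : Phi t - Phi s = \int[mu]_(x in `[s, t]) k x.
  have gi' := gi s t s0; have fi' := integrable_scale (e t) fst.
  rewrite RintegralB// RintegralD//.
  rewrite RintegralZl// [X in _ = _ - X]RintegralZl// ede//.
  rewrite /Phi (@Rintegral_split g 0 s t) ?s0 ?st//; last exact: gi.
  by rewrite (yE s t)//; ring.
have yM x : s <= x <= t -> `|y x - y s| <= M.
  move=> /andP[sx xt]; rewrite (yE s x)// addrAC subrr add0r.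
  apply: (le_trans (le_normr_Rintegral _ (fi s x s0))) => //.
  rewrite /M (@Rintegral_split _ s x t) ?sx ?xt//; last exact: fni.
  by rewrite lerDl Rintegral_ge0.
have M0 : 0 <= M by exact: Rintegral_ge0.
rewrite incr (le_trans (le_normr_Rintegral _ ki))//.
have ci : mu.-integrable `[s, t] (EFin \o (fun=> rr * M)).
  by apply: continuous_integrable => x; exact: cvg_cst.
have fsi : mu.-integrable `[s, t] (EFin \o (fun x => rr * (t - s) * `|f x|)).
  by apply: integrable_scale; exact: fni.
apply: (@le_trans _ _ (\int[mu]_(x in `[s, t]) (rr * M + rr * (t - s) * `|f x|))).
  apply: le_Rintegral => //; [exact: (integrable_norm ki)|exact: integrable_add|].
  move=> x; rewrite /= in_itv/= => xst; rewrite kE (le_trans (ler_normB _ _))//.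
  apply: lerD; last by rewrite normrM ler_wpM2r// ede2.
  have /e1/andP[e0 e1'] : 0 <= x by case/andP: xst => /(le_trans s0).
  rewrite normrM gtr0_norm// ler_wpM2l ?(ltW rr0)// normrM ger0_norm//.
  by rewrite (le_trans _ (yM x xst))// ler_piMl.
have fnst := fni s t s0.
rewrite RintegralD// Rintegral_cst// RintegralZl//.
rewrite /= lebesgue_measure_itv/= lte_fin.
have -> : fine (if s < t then (t%:E - s%:E)%E else 0%E) = t - s.
  by move: st; rewrite le_eqVlt => /orP[/eqP <-|->//]; rewrite ltxx subrr.
by rewrite -/M le_eqVlt; apply/orP; left; apply/eqP; ring.
Qed.

End Integration.

(** * The cost F inherited from the utility *)

(** The facts on F = - u^-1 on which the control problem depends. Continuity of F'
    is stated through the retraction onto [0, +oo[. *)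
Record regular_cost {R : realType} (u : R -> R) : Prop := RegularCost {
  cost0 : F u 0 = 0;
  cost_decr : decreasing_Rp (F u);
  cost_supergradient : forall x z, 0 <= x -> 0 <= z ->
    F u z <= F u x + F' u x * (z - x);
  cost_deriv_lt0 : forall y, 0 <= y -> F' u y < 0;
  cost_deriv_decr : decreasing_Rp (F' u);
  cost_deriv_surj : forall v, v <= F' u 0 -> exists2 y, 0 <= y & F' u y = v;
  cost_deriv_continuous : continuous (fun z : R => F' u (Num.max z 0)) }.

Section Utility.
Context {R : realType}.
Variable u : R -> R.
Hypotheses (u_incr : increasing_Rp u) (u_conc : strictly_concave_Rp u)
  (u_C1 : C1_Rp u) (u_0 : u 0 = 0) (u'_cvg0 : deriv_Rp u x @[x --> +oo] --> 0).
Local Notation du := (deriv_Rp u).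

(** By concavity the slope of u from x towards z is at least the chord slope, at
    every intermediate point x + t (z - x); let t tend to 0. *)
Lemma u_supergradient x z : 0 <= x -> 0 <= z -> u z <= u x + du x * (z - x).
Proof.
move=> x0 z0; have [->|zx] := eqVneq z x; first by rewrite subrr mulr0 addr0.
rewrite leNgt; apply/negP => lt.
pose eta := u z - (u x + du x * (z - x)).
have eta0 : 0 < eta by rewrite subr_gt0.
have a0 : 0 < `|z - x| by rewrite normr_gt0 subr_eq0.
have e0 : 0 < eta / (2 * `|z - x|) by rewrite divr_gt0// mulr_gt0.
have [dx _] := u_C1; move: (dx x x0); rewrite /derivable_Rp => c.
have {}c : diff_quot u x w @[w --> within `[0, +oo[ x^'] --> du x by exact: c.
move/cvgrPdist_lt : c => /(_ _ e0); rewrite near_withinE/= near_withinE/=.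
move=> /nbhs_ballP[d /= d0 hd].
(* t is small enough for x + t (z - x) to lie in the ball where the slope is
   close to u' x *)
pose t := Num.min (1/2) (d / (2 * `|z - x|)).
have t0 : 0 < t by rewrite /t lt_min divr_gt0//= divr_gt0// mulr_gt0.
have t1 : t < 1 by rewrite /t gt_min; apply/orP; left; lra.
have td : t * `|z - x| < d.
  rewrite (@le_lt_trans _ _ (d / (2 * `|z - x|) * `|z - x|))//.
    by rewrite ler_wpM2r// /t ge_min lexx orbT.
  have -> : d / (2 * `|z - x|) * `|z - x| = d / 2 by field; rewrite gt_eqF.
  lra.
pose w := x + t * (z - x).
have wx : w - x = t * (z - x) by rewrite /w addrAC subrr add0r.
have wx0 : w - x != 0 by rewrite wx mulf_eq0 negb_or gt_eqF//= subr_eq0.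
have w0 : 0 <= w.
  rewrite (_ : w = (1 - t) * x + t * z); last by rewrite /w; ring.
  by rewrite addr_ge0// mulr_ge0// ?subr_ge0 ltW.
have uw : t * (u z - u x) <= u w - u x.
  have [xz|xz] : x < z \/ z < x by apply/orP; rewrite -neq_lt eq_sym.
    have := u_conc x0 xz (_ : 0 < 1 - t) (_ : 1 - t < 1).
    rewrite subr_gt0 t1 gtrBl t0 => /(_ isT isT).
    have -> : (1 - t) * x + (1 - (1 - t)) * z = w by rewrite /w; ring.
    by move=> ?; lra.
  have := u_conc z0 xz t0 t1.
  have -> : t * z + (1 - t) * x = w by rewrite /w; ring.
  by move=> ?; lra.
have := hd w; rewrite /ball/= distrC wx normrM gtr0_norm// => /(_ td).
rewrite -subr_eq0 => /(_ wx0); rewrite in_itv/= andbT => /(_ w0).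
rewrite distrC ltr_norml => /andP[h1 h2].
set k := diff_quot u x w in h1 h2.
have kE : k * (t * (z - x)) = u w - u x.
  by rewrite /k /diff_quot -wx mulfVK.
have kz : u z - u x <= k * (z - x).
  by rewrite -(ler_pM2l t0) mulrCA kE.
have : eta <= (k - du x) * (z - x) by rewrite /eta; lra.
rewrite leNgt => /negP; apply.
apply: (@le_lt_trans _ _ (`|k - du x| * `|z - x|)); first by rewrite -normrM ler_norm.
have : `|k - du x| < eta / (2 * `|z - x|) by rewrite ltr_norml h1.
rewrite -(ltr_pM2r a0) => /lt_trans; apply.
have -> : eta / (2 * `|z - x|) * `|z - x| = eta / 2 by field; rewrite gt_eqF.
lra.
Qed.

(** The weak inequality at the midpoint, where u exceeds the mean strictly. *)
Lemma u_supergradient_lt x z : 0 <= x -> 0 <= z -> z != x ->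
  u z < u x + du x * (z - x).
Proof.
move=> x0 z0 zx; pose w := (1/2) * x + (1/2) * z.
have w0 : 0 <= w by rewrite /w; lra.
have h : 0 < (1/2 : R) by lra.
have h1 : (1/2 : R) < 1 by lra.
have e : 1 - 1/2 = 1/2 :> R by lra.
have uw : (1/2) * u x + (1/2) * u z < u w.
  have [xz|xz] : x < z \/ z < x by apply/orP; rewrite -neq_lt eq_sym.
    by have := u_conc x0 xz h h1; rewrite e.
  by have := u_conc z0 xz h h1; rewrite e addrC (addrC (1/2 * z)).
have := u_supergradient x0 w0.
have -> : w - x = (1/2) * (z - x) by rewrite /w; lra.
by move=> ?; lra.
Qed.

Lemma marginal_decr x z : 0 <= x -> x < z -> du z < du x.
Proof.
move=> x0 xz; have z0 : 0 <= z by rewrite (le_trans x0)// ltW.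
have h1 := @u_supergradient_lt x z x0 z0; rewrite gt_eqF// in h1.
have h2 := @u_supergradient_lt z x z0 x0; rewrite lt_eqF// in h2.
have {}h1 := h1 isT; have {}h2 := h2 isT.
by rewrite -subr_gt0 -(pmulr_lgt0 _ (_ : 0 < z - x)) ?subr_gt0//; lra.
Qed.

Lemma marginal_gt0 x : 0 <= x -> 0 < du x.
Proof.
move=> x0; have x1 : 0 <= x + 1 by lra.
have xx : x < x + 1 by rewrite ltrDl.
by have := u_supergradient x0 x1; have := u_incr x0 xx => ? ?; lra.
Qed.

Lemma marginal_surj v : 0 < v -> v <= du 0 -> exists2 x, 0 <= x & du x = v.
Proof.
move=> v0 v1; have [M M0 Mv] : exists2 M, 0 <= M & du M <= v.
  move/cvgrPdist_le : u'_cvg0 => /(_ _ v0)[M [_ HM]].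
  exists (Num.max M 0 + 1); first by rewrite addr_ge0// le_max lexx orbT.
  have := HM (Num.max M 0 + 1); rewrite sub0r normrN.
  have -> : M < Num.max M 0 + 1 by rewrite (@le_lt_trans _ _ (Num.max M 0)) ?ltrDl// le_max lexx.
  by move=> /(_ isT); apply: le_trans; exact: ler_norm.
have [_ /continuous_Rp c] := u_C1.
have [||x /andP[x0 _] xv] := @IVT_pointwise R (fun z : R => du (Num.max z 0)) 0 M v M0.
- by move=> x _; exact: c.
- by right; rewrite !max_l// Mv v1.
- by exists x => //; rewrite -xv max_l.
Qed.

Lemma u_continuous : continuous (fun z : R => u (Num.max z 0)).
Proof.
move=> x; apply/cvgrPdist_le => e e0.
have m0 := @max0_ge0 R.
have lip y z : 0 <= y -> 0 <= z -> y <= z -> `|u z - u y| <= du 0 * `|z - y|.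
  move=> y0 z0; rewrite le_eqVlt => /orP[/eqP <-|yz].
    by rewrite !subrr normr0 mulr0.
  have uyz := u_incr y0 yz.
  rewrite !gtr0_norm ?subr_gt0// lerBlDl (le_trans (u_supergradient y0 z0))//.
  rewrite lerD2l ler_wpM2r ?subr_ge0 ?(ltW yz)//.
  by move: y0; rewrite le_eqVlt => /orP[/eqP <-//|y0]; rewrite ltW// marginal_decr.
have lip' y z : 0 <= y -> 0 <= z -> `|u z - u y| <= du 0 * `|z - y|.
  move=> y0 z0; have [yz|zy] := leP y z; first exact: lip.
  by rewrite distrC (distrC z); apply: lip => //; exact: ltW.
have d0 := marginal_gt0 (lexx 0).
near=> z.
rewrite (le_trans (lip' _ _ (m0 z) (m0 x)))// -ler_pdivlMl//.
apply: (@le_trans _ _ `|x - z|).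
  rewrite ler_norml; have [xz|zx] := leP x z.
    rewrite (ler0_norm (_ : x - z <= 0)) ?subr_le0//.
    by apply/andP; split; case: (leP x 0); case: (leP z 0) => ? ?; lra.
  rewrite (gtr0_norm (_ : 0 < x - z)) ?subr_gt0//.
  by apply/andP; split; case: (leP x 0); case: (leP z 0) => ? ?; lra.
near: z; apply: cvgr_dist_le; first exact: cvg_id.
by rewrite mulr_gt0// invr_gt0.
Unshelve. all: by end_near. Qed.

Lemma u_inj : {in `[0, +oo[%classic &, injective u}.
Proof.
move=> x y; rewrite !inE/= !in_itv/= !andbT => x0 y0 e.
by case: (ltgtP x y) => // /u_incr h; [move: (h x0)|move: (h y0)]; rewrite e ltxx.
Qed.

Lemma F_u x : 0 <= x -> F u (u x) = - x.
Proof.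
move=> x0; congr (- _); apply: pinvKV; first exact: u_inj.
by rewrite inE/= in_itv/= x0.
Qed.

Hypothesis u_unbounded : forall y, exists2 x, 0 <= x & y <= u x.

Lemma u_surj y : 0 <= y -> exists2 x, 0 <= x & u x = y.
Proof.
move=> y0; have [M M0 yM] := u_unbounded y.
have [||x /andP[x0 _] xv] := @IVT_pointwise R (fun z : R => u (Num.max z 0)) 0 M y M0.
- by move=> x _; exact: u_continuous.
- by left; rewrite !max_l// u_0 y0.
- by exists x => //; rewrite -xv max_l.
Qed.

Lemma u_ltE x y : 0 <= x -> 0 <= y -> (u x < u y) = (x < y).
Proof.
move=> x0 y0; apply/idP/idP => [|]; last exact: u_incr.
by rewrite !ltNge; apply: contra; rewrite le_eqVlt => /orP[/eqP ->//|/u_incr/ltW]; exact.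
Qed.

Lemma F_0 : F u 0 = 0.
Proof. by rewrite -u_0 F_u// oppr0. Qed.

Lemma F_decr : decreasing_Rp (F u).
Proof.
move=> y z y0 yz; have z0 := le_trans y0 (ltW yz).
have [a a0 ea] := u_surj y0; have [b b0 eb] := u_surj z0.
by move: yz; rewrite -ea -eb !F_u// ltrN2 u_ltE.
Qed.

(** The derivative of F predicted by the inverse function theorem. It is shown to
    be a supergradient of F; its monotonicity and range give its continuity. *)
Let G y := - (du (- F u y))^-1.

Let G_u x : 0 <= x -> G (u x) = - (du x)^-1.
Proof. by move=> x0; rewrite /G F_u// opprK. Qed.

Let F_superG x z : 0 <= x -> 0 <= z -> F u z <= F u x + G x * (z - x).
Proof.
move=> x0 z0; have [a a0 <-] := u_surj x0; have [b b0 <-] := u_surj z0.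
rewrite !F_u// G_u//; have d := marginal_gt0 a0.
have := u_supergradient a0 b0.
rewrite -lerBlDl -ler_pdivrMl// => h.
by rewrite mulNr -opprD lerN2; lra.
Qed.

Let G_decr x z : 0 <= x -> x < z -> G z < G x.
Proof.
move=> x0 xz; have z0 := le_trans x0 (ltW xz).
have [a a0 ea] := u_surj x0; have [b b0 eb] := u_surj z0.
move: xz; rewrite -ea -eb !G_u// u_ltE// => ab.
by rewrite ltrN2 ltf_pV2 ?marginal_decr// posrE marginal_gt0.
Qed.

Let G_surj v : v <= G 0 -> exists2 y, 0 <= y & G y = v.
Proof.
have G0 : G 0 = - (du 0)^-1 by rewrite -[in LHS]u_0 G_u.
rewrite G0 => vG; have d0 := marginal_gt0 (lexx 0).
have v0 : v < 0 by rewrite (le_lt_trans vG)// oppr_lt0 invr_gt0.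
have [||x x0 xv] := @marginal_surj (- v^-1).
- by rewrite oppr_gt0 invr_lt0.
- by rewrite -invrN -[leRHS]invrK lef_pV2 ?posrE ?invr_gt0 ?oppr_gt0// lerNr.
exists (u x); first by rewrite -u_0; move: x0; rewrite le_eqVlt => /orP[/eqP <-//|/u_incr/ltW]; exact.
by rewrite G_u// xv invrN opprK invrK.
Qed.

Let G_cont : continuous (fun z : R => G (Num.max z 0)).
Proof.
have m0 := @max0_ge0 R.
apply: nonincreasing_continuous => [x y xy|x y v xy].
  have : Num.max x 0 <= Num.max y 0 by rewrite ge_max !le_max xy lexx orbT.
  by rewrite le_eqVlt => /orP[/eqP ->//|/G_decr/ltW]; exact.
move=> /andP[_ vx]; have [|z z0 zv] := @G_surj v.
  rewrite (le_trans (ltW vx))//; have := m0 x.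
  by rewrite le_eqVlt => /orP[/eqP <-//|/G_decr/ltW]; exact.
by exists z; rewrite max_l.
Qed.

Let F'E y : 0 <= y -> F' u y = G y.
Proof.
move=> y0; apply: (@supergradient_Rp _ (F u) G y y0 _ (@G_cont y)).2.
by move=> z z0; split; exact: F_superG.
Qed.

Lemma F'_lt0 y : 0 <= y -> F' u y < 0.
Proof.
by move=> y0; rewrite F'E//; have [a a0 <-] := u_surj y0; rewrite G_u// oppr_lt0 invr_gt0 marginal_gt0.
Qed.

Lemma F_supergradient x z : 0 <= x -> 0 <= z -> F u z <= F u x + F' u x * (z - x).
Proof. by move=> x0 z0; rewrite F'E//; exact: F_superG. Qed.

Lemma F'_decr : decreasing_Rp (F' u).
Proof. by move=> x z x0 xz; rewrite !F'E ?(le_trans x0 (ltW xz))//; exact: G_decr. Qed.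

Lemma F'_surj v : v <= F' u 0 -> exists2 y, 0 <= y & F' u y = v.
Proof. by rewrite F'E// => /G_surj[y y0 <-]; exists y; rewrite ?F'E. Qed.

Lemma F'_continuous : continuous (fun z : R => F' u (Num.max z 0)).
Proof.
rewrite (_ : (fun z => _) = (fun z : R => G (Num.max z 0))); first exact: G_cont.
by apply/funext => z; rewrite F'E// le_max lexx orbT.
Qed.

Lemma utility_regular_cost : regular_cost u.
Proof.
split; [exact: F_0|exact: F_decr|exact: F_supergradient|exact: F'_lt0|exact: F'_decr
  |exact: F'_surj|exact: F'_continuous].
Qed.

End Utility.

Section UtilityGrowth.
Context {R : realType}.
Variables (u : R -> R) (c0 c1 gamma : R).
Hypotheses (c0_gt0 : 0 < c0) (c1_gt0 : 0 < c1) (gamma_gt1 : 1 < gamma)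
  (u_growth : forall x, 0 <= x ->
    c0 * (- 1 + x `^ gamma^-1) <= u x <= c1 * (1 + x `^ gamma^-1)).

Let gamma0 : 0 < gamma. Proof. by rewrite (lt_trans ltr01). Qed.

Lemma u_unbounded_growth y : exists2 x, 0 <= x & y <= u x.
Proof.
have b0 : 0 <= `|y| / c0 + 1 by rewrite addr_ge0// divr_ge0// ltW.
exists ((`|y| / c0 + 1) `^ gamma); first exact: powR_ge0.
have /andP[h _] := u_growth (powR_ge0 (`|y| / c0 + 1) gamma).
rewrite (le_trans _ h)// -powRrM divff ?gt_eqF// powRr1//.
by rewrite addrCA addNr addr0 mulrCA divff ?gt_eqF// mulr1 ler_norm.
Qed.

Lemma powR_invK x : 0 <= x -> (x `^ gamma^-1) `^ gamma = x.
Proof. by move=> x0; rewrite -powRrM mulVf ?gt_eqF// powRr1. Qed.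

Hypotheses (u_surjective : forall y, 0 <= y -> exists2 x, 0 <= x & u x = y)
  (Fu : forall x, 0 <= x -> F u (u x) = - x).

Lemma F_growth_lower : exists2 d, 0 < d &
  forall y, 0 <= y -> d * (- 1 - y `^ gamma) <= F u y.
Proof.
exists (2 `^ gamma * (1 + c0^-1 `^ gamma)).
  by rewrite mulr_gt0 ?powR_gt0// addr_gt0// powR_gt0// invr_gt0.
move=> y y0; have [x x0 xy] := u_surjective y0.
rewrite -{2}xy Fu// lerNr -mulrN opprB opprK.
have /andP[+ _] := u_growth x0; rewrite xy => h.
(* the power of a sum is controlled by 1 + a <= 2 max(1, a), with a = y / c0 *)
have hx : x `^ gamma^-1 <= 1 + y / c0.
  by rewrite -(ler_pM2l c0_gt0) mulrDr mulrCA divff ?gt_eqF//; lra.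
have yc0 : 0 <= y / c0 by rewrite divr_ge0// ltW.
have mono a b := @ler_powR_nneg R gamma a b (ltW gamma0).
have h1 : x <= (1 + y / c0) `^ gamma.
  by rewrite -{1}(powR_invK x0); apply: mono hx; exact: powR_ge0.
apply: (le_trans h1); have p0 := powR_ge0.
have [yc|yc] := leP (y / c0) 1.
  apply: (@le_trans _ _ (2 `^ gamma)); first by apply: mono; lra.
  rewrite -mulrA ler_peMr// mulrDr mulr1 addrC.
  by have := p0 R c0^-1 gamma; have := p0 R y gamma; nra.
apply: (@le_trans _ _ ((2 * (y / c0)) `^ gamma)); first by apply: mono; lra.
rewrite powRM// powRM ?invr_ge0 ?(ltW c0_gt0)// -mulrA ler_wpM2l//.
by have := p0 R c0^-1 gamma; have := p0 R y gamma; nra.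
Qed.

Hypothesis F_nonpos : forall y, 0 <= y -> F u y <= 0.

Lemma F_growth_upper y : 0 <= y -> F u y <= 1 - (y / (2 * c1)) `^ gamma.
Proof.
move=> y0; have c20 : 0 < 2 * c1 by rewrite mulr_gt0.
have yc0 : 0 <= y / (2 * c1) by rewrite divr_ge0// ltW.
have mono a b := @ler_powR_nneg R gamma a b (ltW gamma0).
(* below 2 c1 the bound is nonnegative; above, y / c1 - 1 >= y / (2 c1) *)
have [yc|yc] := leP (y / (2 * c1)) 1.
  rewrite (le_trans (F_nonpos y0))// subr_ge0 (le_trans (mono _ _ yc0 yc))//.
  by rewrite powR1.
have [x x0 xy] := u_surjective y0.
rewrite -{1}xy Fu//; have /andP[_ +] := u_growth x0; rewrite xy => h.
have hx : y / (2 * c1) <= x `^ gamma^-1.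
  have e : y / (2 * c1) * (2 * c1) = y by rewrite divfK// gt_eqF.
  set k := y / (2 * c1) in yc e *.
  by rewrite -(ler_pM2l c1_gt0); nra.
by have := mono _ _ yc0 hx; rewrite powR_invK//; lra.
Qed.

End UtilityGrowth.

(** * The concave conjugate of F *)

Section Conjugate.
Context {R : realType}.
Variable u : R -> R.
Hypothesis reg : regular_cost u.
Local Notation F := (F u).
Local Notation F' := (F' u).
Local Notation Fstar := (Fstar u).

(** The point where the infimum defining Fstar p is attained, hence the derivative
    of Fstar: the inverse of F' up to F' 0 and, by the default of xget, 0 beyond. *)
Definition maximizer (p : R) : R := xget 0 [set y | 0 <= y /\ F' y = p].
Local Notation phi := maximizer.

Lemma cost_le0 y : 0 <= y -> F y <= 0.
Proof.
rewrite le_eqVlt => /orP[/eqP <-|y0]; first by rewrite (cost0 reg).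
by have := cost_decr reg (lexx 0) y0; rewrite (cost0 reg) => /ltW.
Qed.

Lemma cost_deriv_le x y : 0 <= x -> x <= y -> F' y <= F' x.
Proof.
by move=> x0; rewrite le_eqVlt => /orP[/eqP ->//|/(cost_deriv_decr reg x0)/ltW].
Qed.

Lemma maximizerP p : p <= F' 0 -> 0 <= phi p /\ F' (phi p) = p.
Proof.
move=> /(cost_deriv_surj reg)[y y0 yp].
by apply: (@xgetPex R 0 [set y | 0 <= y /\ F' y = p]); exists y.
Qed.

Lemma maximizer_out p : F' 0 < p -> phi p = 0.
Proof.
move=> p0; apply: xgetPN => y [y0 yp].
by move: p0; rewrite -yp ltNge cost_deriv_le.
Qed.

Lemma maximizer_ge0 p : 0 <= phi p.
Proof. by have [/maximizerP[]|/maximizer_out ->] := leP p (F' 0). Qed.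

Lemma maximizer_cost_deriv y : 0 <= y -> phi (F' y) = y.
Proof.
move=> y0; have [] := maximizerP (cost_deriv_le (lexx 0) y0) => p0 e.
case: (ltgtP (phi (F' y)) y) => // h.
  by have := cost_deriv_decr reg p0 h; rewrite e ltxx.
by have := cost_deriv_decr reg y0 h; rewrite e ltxx.
Qed.

Lemma maximizer_eq0 p : F' 0 <= p -> phi p = 0.
Proof.
by rewrite le_eqVlt => /orP[/eqP <-|/maximizer_out//]; rewrite maximizer_cost_deriv.
Qed.

Lemma maximizer_lt p q : p < F' 0 -> p < q -> phi q < phi p.
Proof.
move=> pF pq; have [pp ep] := maximizerP (ltW pF).
have [qF|qF] := leP q (F' 0).
  have [qp eq] := maximizerP qF; rewrite ltNge; apply/negP => /(cost_deriv_le pp).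
  by rewrite ep eq leNgt pq.
rewrite maximizer_out// lt_neqAle pp andbT; apply/eqP => e.
by move: pF; rewrite -ep -e ltxx.
Qed.

Lemma maximizer_le p q : p <= q -> phi q <= phi p.
Proof.
rewrite le_eqVlt => /orP[/eqP ->//|pq]; have [/maximizer_lt/(_ pq)/ltW//|h] := ltP p (F' 0).
by rewrite !maximizer_eq0// (le_trans h)// ltW.
Qed.

Lemma maximizer_gt0 p : p < F' 0 -> 0 < phi p.
Proof. by move=> pF; rewrite (le_lt_trans _ (maximizer_lt pF pF))// maximizer_ge0. Qed.

Lemma maximizer_continuous : continuous phi.
Proof.
apply: nonincreasing_continuous; first exact: maximizer_le.
move=> x y v xy /andP[yv _]; exists (F' v); apply: maximizer_cost_deriv.
by rewrite (le_trans (maximizer_ge0 y))// ltW.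
Qed.

Lemma FstarE p : Fstar p = phi p * p - F (phi p).
Proof.
have lb y : 0 <= y -> phi p * p - F (phi p) <= y * p - F y.
  move=> y0; have := cost_supergradient reg (maximizer_ge0 p) y0.
  have [/maximizerP[_ ->]|pF] := leP p (F' 0); first by move=> ?; lra.
  by rewrite maximizer_out// (cost0 reg); nra.
apply/eqP; rewrite eq_le; apply/andP; split.
  apply: ge_inf; first by exists (phi p * p - F (phi p)) => _ [y /= /[!in_itv]/= /andP[y0 _] <-]; exact: lb.
  by exists (phi p) => //; rewrite /= in_itv/= maximizer_ge0.
apply: lb_le_inf; first by exists (phi p * p - F (phi p)), (phi p) => //; rewrite /= in_itv/= maximizer_ge0.
by move=> _ [y /= /[!in_itv]/= /andP[y0 _] <-]; exact: lb.
Qed.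

Lemma Fstar_le p y : 0 <= y -> Fstar p <= y * p - F y.
Proof.
move=> y0; rewrite FstarE; have := cost_supergradient reg (maximizer_ge0 p) y0.
have [/maximizerP[_ ->]|pF] := leP p (F' 0); first by move=> ?; lra.
by rewrite maximizer_out// (cost0 reg); nra.
Qed.

Lemma Fstar_supergradient p q : Fstar q <= Fstar p + phi p * (q - p).
Proof.
by rewrite (le_trans (Fstar_le q (maximizer_ge0 p)))// FstarE; lra.
Qed.

(** The envelope theorem: Fstar is an infimum of affine functions, so its minimizer
    is a supergradient. *)
Lemma Fstar_is_derive p : is_derive p (1:R) Fstar (phi p).
Proof.
apply: supergradient_is_derive; last exact: maximizer_continuous.
by move=> z; split; exact: Fstar_supergradient.
Qed.

Lemma Fstar_continuous : continuous Fstar.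
Proof. by move=> p; exact: isder_cont (Fstar_is_derive p). Qed.

Lemma Fstar_eq0 p : F' 0 <= p -> Fstar p = 0.
Proof. by move=> pF; rewrite FstarE maximizer_eq0// (cost0 reg); lra. Qed.

Lemma le_Fstar p q : p <= q -> Fstar p <= Fstar q.
Proof.
move=> pq; have := Fstar_supergradient q p; have := maximizer_ge0 q; nra.
Qed.

Lemma lt_Fstar p q : p < F' 0 -> p < q -> Fstar p < Fstar q.
Proof.
move=> pF pq; have [qF|qF] := ltP q (F' 0).
  have := Fstar_supergradient q p; have := maximizer_gt0 qF; nra.
rewrite (@lt_le_trans _ _ (Fstar (F' 0)))//; last exact: le_Fstar.
rewrite [ltRHS]Fstar_eq0// FstarE.
have [p0 pE] := maximizerP (ltW pF); have pg := maximizer_gt0 pF.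
have := cost_supergradient reg p0 (lexx 0); rewrite (cost0 reg) pE.
(* F is strictly concave, so its tangent at phi p is above F 0 at 0, strictly;
   two tangent inequalities through the midpoint h show it *)
pose h := phi p / 2; have h0 : 0 <= h by rewrite /h; lra.
have hp : h < phi p by rewrite /h; lra.
have h0' : 0 < h by rewrite /h; lra.
have a1 := cost_supergradient reg p0 h0; rewrite pE in a1.
have a2 := cost_supergradient reg h0 (lexx 0); rewrite (cost0 reg) in a2.
have a3 := cost_deriv_decr reg h0 hp; rewrite pE in a3.
by move=> _; nra.
Qed.

Lemma Fstar_invP v : v < 0 -> Fstar_inv u v < F' 0 /\ Fstar (Fstar_inv u v) = v.
Proof.
move=> v0; have F1 := cost_decr reg (lexx 0) ltr01; rewrite (cost0 reg) in F1.
pose M := Num.min (v + F 1) (F' 0).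
have MF : M <= F' 0 by rewrite /M ge_min lexx orbT.
have Mv : Fstar M <= v.
  rewrite (le_trans (Fstar_le M ler01))// mul1r lerBlDr.
  by rewrite /M ge_min lexx.
have [|p /andP[_ pF] pv] := IVT_pointwise MF (fun x _ => @Fstar_continuous x) (v := v).
  by left; rewrite Mv Fstar_eq0// ltW.
have {}pF : p < F' 0.
  rewrite lt_neqAle pF andbT; apply/eqP => e; move: v0.
  by rewrite -pv e Fstar_eq0// ltxx.
suff -> : Fstar_inv u v = p by [].
rewrite -pv; apply: pinvKV; last by rewrite inE/= in_itv.
move=> x y; rewrite !inE/= !in_itv/= => xF yF e.
by case: (ltgtP x y) => // /lt_Fstar; [move=> /(_ xF)|move=> /(_ yF)]; rewrite e ltxx.
Qed.

End Conjugate.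

(** * The free boundary *)

(** What the two regimes of m have in common. In terms of the costate p, which
    plays the part of the derivative of the value function, one continues below
    ps and stops above. smooth_fit is Fdm yb = 0 when yb > 0, and the definition
    of ps when yb = 0. For p <= F' 0 the expression bounded in continue_below and
    stop_above is - Fdm (maximizer u p). *)
Record threshold {R : realType} (D m : R) (u : R -> R) (ps yb : R) : Prop := Threshold {
  ps_lt0 : ps < 0;
  Dps_lt : D * ps < F' u 0;
  maximizer_ps : maximizer u ps = yb;
  smooth_fit : (D - 1) * ps * yb = Fstar u (D * ps) + m - Fstar u ps;
  continue_below : forall p, p <= ps ->
    0 <= (D - 1) * p * maximizer u p + Fstar u p - Fstar u (D * p) - m;
  stop_above : forall p, ps <= p ->
    (D - 1) * p * maximizer u p + Fstar u p - Fstar u (D * p) - m <= 0 }.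

Section Threshold.
Context {R : realType}.
Variables (r rho m : R) (u : R -> R).
Hypotheses (reg : regular_cost u) (m_gt0 : 0 < m) (delta_gt1 : 1 < delta r rho)
  (Fdm_decr : decreasing_Rp (Fdm r rho m u))
  (Fdm_cvg : Fdm r rho m u y @[y --> +oo] --> -oo).
Local Notation F := (F u).
Local Notation F' := (F' u).
Local Notation Fstar := (Fstar u).
Local Notation phi := (maximizer u).
Local Notation D := (delta r rho).
Local Notation Fdm := (Fdm r rho m u).
Local Notation ybar := (ybar r rho m u).
Local Notation pstar := (pstar r rho m u).
Local Notation small_m := (small_m r rho m u).

Let D0 : 0 < D. Proof. exact: lt_trans delta_gt1. Qed.

Lemma cost_deriv0_lt0 : F' 0 < 0.
Proof. exact: (cost_deriv_lt0 reg). Qed.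

Lemma Fdm0 : Fdm 0 = Fstar (D * F' 0) + m.
Proof. by rewrite /Defs.Fdm (cost0 reg) mulr0 mul0r subr0 addr0. Qed.

Lemma small_mE : small_m = (Fdm 0 <= 0).
Proof. by rewrite Fdm0 -lerBrDl sub0r. Qed.

Lemma cost_max_continuous : continuous (fun z : R => F (Num.max z 0)).
Proof.
have cm := @continuous_max0 R.
have -> : (fun z : R => F (Num.max z 0)) =
    (fun z => Num.max z 0 * F' (Num.max z 0) - Fstar (F' (Num.max z 0))).
  apply/funext => z; have z0 : 0 <= Num.max z 0 by rewrite le_max lexx orbT.
  by rewrite FstarE// maximizer_cost_deriv//; ring.
have c' := cost_deriv_continuous reg.
move=> z; apply: cvgB; first by apply: cvgM; [exact: cm|exact: c'].
apply: (@continuous_comp _ _ _ (fun z : R => F' (Num.max z 0)) Fstar); first exact: c'.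
exact: Fstar_continuous.
Qed.

Lemma Fdm_continuous : continuous (fun z : R => Fdm (Num.max z 0)).
Proof.
have cm := @continuous_max0 R.
have c' := cost_deriv_continuous reg.
move=> z; apply: cvgD; last exact: cvg_cst.
apply: cvgD; last exact: cost_max_continuous.
apply: cvgB; last by apply: cvgM; [apply: cvgM; [exact: cvg_cst|exact: cm]|exact: c'].
apply: (@continuous_comp _ _ _ (fun z : R => D * F' (Num.max z 0)) Fstar).
  by apply: cvgM; [exact: cvg_cst|exact: c'].
exact: Fstar_continuous.
Qed.

Lemma ybar_small : small_m -> ybar = 0.
Proof.
rewrite small_mE => s; apply/eqP; rewrite eq_le; apply/andP; split.
  by apply: ge_inf; [exists 0 => y []|split].
by apply: lb_le_inf; [exists 0; split|move=> y []].
Qed.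

Lemma ybar_large : ~~ small_m -> 0 < ybar /\ Fdm ybar = 0.
Proof.
rewrite small_mE -ltNge => s.
have [M M0 FM] : exists2 M, 0 <= M & Fdm M <= 0.
  move/cvgrNyPle : Fdm_cvg => /(_ 0)[M [_ HM]]; exists (Num.max M 0 + 1).
    by rewrite addr_ge0// le_max lexx orbT.
  by apply: HM; rewrite (@le_lt_trans _ _ (Num.max M 0)) ?ltrDl// le_max lexx.
have [|y /andP[y0 _] e] := IVT_pointwise M0 (fun x _ => @Fdm_continuous x) (v := 0).
  by right; rewrite !max_l// FM ltW.
rewrite max_l// in e.
have {}y0 : 0 < y.
  rewrite lt_neqAle y0 andbT; apply/eqP => y0'.
  by move: e s; rewrite -y0' => ->; rewrite ltxx.
suff -> : ybar = y by [].
apply/eqP; rewrite eq_le; apply/andP; split.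
  by apply: ge_inf; [exists 0 => z []|split; [exact: ltW|rewrite e]].
apply: lb_le_inf; first by exists y; split; [exact: ltW|rewrite e].
move=> z [z0 Fz]; rewrite leNgt; apply/negP => /(Fdm_decr z0).
by rewrite e ltNge Fz.
Qed.

Lemma ybar_ge0 : 0 <= ybar.
Proof. by have [/ybar_small ->|/ybar_large[/ltW]] := boolP small_m. Qed.

Let bracketE p : p <= F' 0 ->
  (D - 1) * p * phi p + Fstar p - Fstar (D * p) - m = - Fdm (phi p).
Proof.
by move=> /(maximizerP reg)[_ e]; rewrite /Defs.Fdm e [Fstar p]FstarE//; ring.
Qed.

Let bracketE0 p : F' 0 <= p ->
  (D - 1) * p * phi p + Fstar p - Fstar (D * p) - m = - Fstar (D * p) - m.
Proof. by move=> h; rewrite maximizer_eq0// Fstar_eq0//; ring. Qed.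

(** Here ps >= F' 0, so stopping is optimal at the state 0 only. *)
Lemma threshold_small : small_m ->
  pstar = Fstar_inv u (- m) / D /\ threshold D m u pstar ybar.
Proof.
move=> s; have m0 : - m < 0 by rewrite oppr_lt0.
have [qF qE] := Fstar_invP reg m0.
have pE : pstar = Fstar_inv u (- m) / D by rewrite /Defs.pstar s mulr1 mulr0 addr0.
have DpE : D * pstar = Fstar_inv u (- m) by rewrite pE mulrC divfK// gt_eqF.
have Fp : F' 0 <= pstar.
  rewrite -(ler_pM2l D0) DpE leNgt; apply/negP => /(lt_Fstar reg qF).
  by rewrite qE ltrNl ltNge -/(small_m) s.
split=> //; split.
- by rewrite -(pmulr_rlt0 _ D0) DpE (lt_trans qF)// cost_deriv0_lt0.
- by rewrite DpE.
- by rewrite maximizer_eq0// ybar_small.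
- by rewrite ybar_small// DpE qE (Fstar_eq0 reg Fp) mulr0; ring.
- move=> p pp; have [pF|pF] := leP p (F' 0).
    rewrite bracketE// oppr_ge0; move: (s); rewrite small_mE; apply: le_trans.
    have := maximizer_ge0 reg p; rewrite le_eqVlt => /orP[/eqP <-//|].
    by move=> /(Fdm_decr (lexx 0))/ltW.
  rewrite bracketE0 ?(ltW pF)// subr_ge0 lerNr -qE -DpE; apply: le_Fstar => //.
  by rewrite ler_pM2l.
- move=> p pp; rewrite bracketE0 ?(le_trans Fp)// subr_le0 lerNl -qE -DpE.
  by apply: le_Fstar => //; rewrite ler_pM2l.
Qed.

(** Here ps = F' ybar, so the derivative of the value function agrees with that of
    F at the boundary of the stopping region. *)
Lemma threshold_large : ~~ small_m ->
  pstar = F' ybar /\ threshold D m u pstar ybar.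
Proof.
move=> s; have [y0 yE] := ybar_large s.
have pE : pstar = F' ybar by rewrite /Defs.pstar (negbTE s) mulr1 mulr0 add0r.
have pF : pstar < F' 0 by rewrite pE; exact: (cost_deriv_decr reg).
have p0 := lt_trans pF cost_deriv0_lt0.
have ph : phi pstar = ybar by rewrite pE maximizer_cost_deriv// ltW.
split=> //; split=> //.
- by rewrite (lt_trans _ pF)// gtr_nMl.
- have := bracketE (ltW pF); rewrite ph yE oppr0 => h; lra.
- move=> p pp; rewrite bracketE ?(le_trans pp (ltW pF))// oppr_ge0 -yE -ph.
  move: (maximizer_le reg pp); rewrite le_eqVlt => /orP[/eqP <-//|/Fdm_decr/ltW]; apply.
  exact: maximizer_ge0.
- move=> p pp; have [pF'|pF'] := leP p (F' 0).
    rewrite bracketE// oppr_le0 -yE -ph.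
    move: (maximizer_le reg pp); rewrite le_eqVlt => /orP[/eqP <-//|/Fdm_decr/ltW]; apply.
    exact: maximizer_ge0.
  rewrite bracketE0 ?(ltW pF')// subr_le0 lerNl.
  have h : - m < Fstar (D * F' 0).
    by move: s; rewrite /Defs.small_m -ltNge ltrNl.
  by rewrite (le_trans (ltW h))//; apply: le_Fstar => //; rewrite ler_pM2l// ltW.
Qed.

Lemma threshold_pstar : threshold D m u pstar ybar.
Proof. by have [/threshold_small[]|/threshold_large[]] := boolP small_m. Qed.

(** For small m the last term of wstar is absent, and it vanishes here because
    Fstar does at pstar; one formula thus serves both regimes. *)
Lemma wstarE p : wstar r rho m u p =
  (- p) `^ (1 - D)^-1 / (D - 1) *
    \int[lebesgue_measure]_(x in `[p, pstar])
      (Fstar (D * x) / (- x) `^ (1 + (1 - D)^-1))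
  + m * (1 - (p / pstar) `^ (1 - D)^-1)
  + (p / pstar) `^ (1 - D)^-1 * Fstar pstar.
Proof.
rewrite /wstar; congr (_ + _); have [s|s] := boolP small_m.
  have [_ t] := threshold_small s.
  rewrite mulr0 Fstar_eq0 ?mulr0// leNgt; apply/negP => h.
  by have := maximizer_gt0 reg h; rewrite (maximizer_ps t) ybar_small// ltxx.
by have [<- _] := threshold_large s; rewrite mulr1.
Qed.

End Threshold.

(** * The dual value function *)

(** The equation V(z) = D z V'(z) - Fstar(D V'(z)) - m of the continuation region
    becomes linear under the Legendre transform p = V'(z), w = p z - V(z), z = w'.
    Its solution is taken on the whole negative axis, past ps, so that w and
    y = w' are differentiable at ps as well. *)
Record dual_solution {R : realType} (D m : R) (u : R -> R) (ps : R)
    (w y : R -> R) : Prop := DualSolution {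
  dual_derive : forall p : R, p < 0 -> is_derive p (1:R) w (y p);
  dual_ode : forall p : R, p < 0 -> (D - 1) * p * y p + w p = Fstar u (D * p) + m;
  dual_boundary : w ps = Fstar u ps;
  dual_derive2 : forall p : R, p < 0 ->
    is_derive p (1:R) y (D * (maximizer u (D * p) - y p) / ((D - 1) * p)) }.

Section DualExistence.
Context {R : realType}.
Variables (D m : R) (u : R -> R) (ps : R).
Hypotheses (reg : regular_cost u) (D1 : 1 < D) (ps0 : ps < 0).
Local Notation F := (F u).
Local Notation Fstar := (Fstar u).
Local Notation phi := (maximizer u).
Let a := (1 - D)^-1.

(** Variation of constants, with integrating factor (- p)^(- a); the constant is
    fixed by the boundary value at ps. *)
Lemma dual_solution_exists : exists w y, dual_solution D m u ps w y /\
  forall p, p <= ps -> w p =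
  (- p) `^ a / (D - 1) *
    \int[lebesgue_measure]_(x in `[p, ps]) (Fstar (D * x) / (- x) `^ (1 + a))
  + m * (1 - (p / ps) `^ a) + (p / ps) `^ a * Fstar ps.
Proof.
have D10 : D - 1 != 0 by rewrite gt_eqF// subr_gt0.
have aE : a = - (D - 1)^-1 by rewrite -invrN opprB.
have dFD (x : R) : is_derive x (1:R) (fun x => Fstar (D * x)) (D * phi (D * x)).
  apply: (isder_eq (isder_comp (isder_scale D (isder_id x)) (Fstar_is_derive reg (D * x)))).
  by rewrite mulr1 mulrC.
pose k x := Fstar (D * x) / (- x) `^ (1 + a).
have kc (x : R) : x < 0 -> {for x, continuous k}.
  move=> x0; apply: cvgM; first exact: isder_cont (dFD x).
  apply: cvgV; first by rewrite gt_eqF// powR_gt0// oppr_gt0.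
  exact: isder_cont (isder_powRN _ x0).
have [K [dK KE]] := antiderivative_tail ps0 kc.
pose S p := (D - 1)^-1 * K p + (Fstar ps - m) * (- ps) `^ (- a).
pose w p := (- p) `^ a * S p + m.
pose y p := (Fstar (D * p) + m - w p) / ((D - 1) * p).
have dw (p : R) : p < 0 -> is_derive p (1:R) w (y p).
  move=> p0; have pn0 : 0 < - p by rewrite oppr_gt0.
  have dS := isder_add (isder_scale (D - 1)^-1 (dK p p0)) (isder_cst p ((Fstar ps - m) * (- ps) `^ (- a))).
  apply: (isder_eq (isder_add (isder_mul (isder_powRN a p0) dS) (isder_cst p m))).
  have q0 : (- p) `^ a != 0 by rewrite gt_eqF// powR_gt0.
  rewrite -/(S p) /y /w /k powRB ?(gt_eqF pn0) ?implybT// powRD ?(gt_eqF pn0) ?implybT//.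
  rewrite !powRr1 ?(ltW pn0)// {3}aE opprK.
  by field; rewrite D10 q0 lt_eqF.
have yode (p : R) : p < 0 -> (D - 1) * p * y p + w p = Fstar (D * p) + m.
  by move=> p0; rewrite /y mulrC divfK ?subrK// mulf_neq0// lt_eqF.
exists w, y; split.
  split=> //.
  - rewrite /w /S -KE// set_itv1 Rintegral_set1 mulr0 add0r mulrCA -powRD ?subrr ?powRr0 ?mulr1 ?subrK//.
    by rewrite oppr_eq0 (lt_eqF ps0) implybT.
  - move=> p p0; have pD0 : (D - 1) * p != 0 by rewrite mulf_neq0// lt_eqF.
    have dn : is_derive p (1:R) (fun p : R => Fstar (D * p) + m - w p) (D * phi (D * p) + 0 - y p).
      exact: (isder_add (isder_add (dFD p) (isder_cst p m)) (isder_opp (dw p p0))).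
    have dd : is_derive p (1:R) (fun p : R => ((D - 1) * p)^-1) (- ((D - 1) * p) ^- 2 * (D - 1)).
      have dl : is_derive p (1:R) (fun p : R => (D - 1) * p) (D - 1).
        by apply: (isder_eq (isder_scale (D - 1) (isder_id p))); rewrite mulr1.
      by have := is_deriveV pD0 dl.
    apply: (isder_eq (isder_mul dn dd)).
    have := yode p p0 => <-.
    rewrite addrK; field; by rewrite D10 lt_eqF.
move=> p pp; have p0 := le_lt_trans pp ps0.
rewrite -[\int[_]_(x in _) _]/(\int[lebesgue_measure]_(x in `[p, ps]) k x) (KE p pp).
have -> : (p / ps) `^ a = (- p) `^ a * (- ps) `^ (- a).
  rewrite (_ : p / ps = (- p) * (- ps)^-1); last by rewrite invrN mulrNN.
  rewrite powRM ?invr_ge0 ?oppr_ge0 ?(ltW p0) ?(ltW ps0)// powRN.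
  by rewrite -powR_inv1 ?oppr_ge0 ?(ltW ps0)// powRAC powR_inv1// powR_ge0.
by rewrite /w /S; field.
Qed.

End DualExistence.

Section DualProperties.
Context {R : realType}.
Variables (D m : R) (u : R -> R) (ps yb : R) (w y : R -> R).
Hypotheses (reg : regular_cost u) (D1 : 1 < D)
  (thr : threshold D m u ps yb) (dual : dual_solution D m u ps w y).
Local Notation F := (F u).
Local Notation Fstar := (Fstar u).
Local Notation phi := (maximizer u).

Let D0 : 0 < D. Proof. exact: lt_trans D1. Qed.
Let D10 : 0 < D - 1. Proof. by rewrite subr_gt0. Qed.
Let ps0 : ps < 0. Proof. exact: ps_lt0 thr. Qed.

Lemma dual_point_ps : y ps = yb.
Proof.
have := dual_ode dual ps0; rewrite (dual_boundary dual) => e.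
have c : (D - 1) * ps != 0 by rewrite mulf_eq0 negb_or (gt_eqF D10) (lt_eqF ps0).
by apply: (mulfI c); rewrite (smooth_fit thr) -e; ring.
Qed.

Let b := D / (D - 1).

Let b_gt0 : 0 < b. Proof. exact: divr_gt0. Qed.

Let weight_ge0 (x : R) : 0 <= b * (- x) `^ (b - 1).
Proof. by rewrite mulr_ge0 ?powR_ge0// ltW. Qed.

(** The weight (- x)^b is the integrating factor of the linear equation solved by
    y. It exhibits y as a weighted mean of values of phi (D x), so that comparing
    y with a constant c reduces to comparing phi (D x) with c. *)
Let weighted_derive (c p : R) : p < 0 ->
  is_derive p (1:R) (fun x : R => (- x) `^ b * (y x - c))
    (b * (- p) `^ (b - 1) * (c - phi (D * p))).
Proof.
move=> p0; have pn0 : 0 < - p by rewrite oppr_gt0.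
apply: (isder_eq (isder_mul (isder_powRN b p0) (isder_add (dual_derive2 dual p0) (isder_cst p (- c))))).
rewrite powRB ?(gt_eqF pn0) ?implybT// powRr1 ?(ltW pn0)//.
rewrite /b; field; rewrite (gt_eqF D10) (lt_eqF p0).
by [].
Qed.

(** The value y p is a mean of yb = phi ps and of phi (D x) for x in [p, ps]; all
    of these are at most phi (D p), and the first is strictly smaller. Hence the
    optimal control exceeds the state, and the state decreases. *)
Lemma dual_point_lt_control p : p <= ps -> y p < phi (D * p).
Proof.
move=> pp; have p0 := le_lt_trans pp ps0.
have h := @is_derive_ge0_le R _ _ p ps pp (fun x xp => @weighted_derive (phi (D * p)) x
  (le_lt_trans (proj2 (andP xp)) ps0)).
have {}h : (- p) `^ b * (y p - phi (D * p)) <= (- ps) `^ b * (y ps - phi (D * p)).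
  apply: h => x /andP[px xp]; have x0 := lt_trans xp ps0.
  rewrite mulr_ge0 ?weight_ge0// subr_ge0; apply: maximizer_le => //.
  by rewrite ler_pM2l// ltW.
have yps : y ps < phi (D * p).
  rewrite dual_point_ps -(maximizer_ps thr).
  apply: (@lt_le_trans _ _ (phi (D * ps))).
    apply: (maximizer_lt reg (Dps_lt thr)).
    by rewrite gtr_nMl.
  by apply: maximizer_le => //; rewrite ler_pM2l.
have wp : 0 < (- p) `^ b by rewrite powR_gt0// oppr_gt0.
have wps : 0 < (- ps) `^ b by rewrite powR_gt0// oppr_gt0.
rewrite -subr_lt0 -(pmulr_rlt0 _ wp) (le_lt_trans h)//.
by rewrite pmulr_rlt0// subr_lt0.
Qed.

Lemma dual_point_decr p q : p < q -> q <= ps -> y q < y p.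
Proof.
move=> pq qp; rewrite -ltrN2.
apply: (@is_derive_gt0_lt R (fun x => - y x)
  (fun x => - (D * (phi (D * x) - y x) / ((D - 1) * x))) p q pq) => x /andP[px xq].
  by apply: isder_opp; apply: (dual_derive2 dual); rewrite (le_lt_trans (le_trans xq qp)).
have x0 : x < 0 by rewrite (lt_trans (lt_le_trans xq qp)).
rewrite oppr_gt0 nmulr_llt0 ?invr_lt0; last first.
  by rewrite nmulr_llt0.
by rewrite mulr_gt0// subr_gt0 dual_point_lt_control// (le_trans (ltW xq)).
Qed.

Lemma dual_point_ge p : p <= ps -> yb <= y p.
Proof.
rewrite -dual_point_ps le_eqVlt => /orP[/eqP ->//|h]; exact: ltW (dual_point_decr h (lexx _)).
Qed.

Lemma yb_ge0 : 0 <= yb.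
Proof. by rewrite -(maximizer_ps thr) maximizer_ge0. Qed.

(** In the mean defining y (2 p), the values phi (D x) with x in [2 p, p] have total
    weight 1 - 2^(- b) and are at least phi (D p), which is as large as desired. *)
Lemma dual_point_unbounded M : exists2 p, p <= ps & M <= y p.
Proof.
pose th : R := 2 `^ (- b).
have th0 : 0 < th by rewrite powR_gt0.
have th1 : th < 1.
  by rewrite /th powRN invf_lt1 ?powR_gt0// /powR gt_eqF// expR_gt1 mulr_gt0// ln_gt0// ltr1n.
pose Y := `|M| / (1 - th).
have Y0 : 0 <= Y by rewrite divr_ge0// subr_ge0 ltW.
(* phi (D p) >= Y by the first bound on p; by the second one, p lies in the
   continuation region *)
pose p := Num.min (F' u Y / D) ps.
have pp : p <= ps by rewrite /p ge_min lexx orbT.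
have p0 : p < 0 by exact: le_lt_trans pp ps0.
have phip : Y <= phi (D * p).
  rewrite -[leLHS](maximizer_cost_deriv reg Y0); apply: maximizer_le => //.
  by rewrite mulrC -ler_pdivlMr// /p ge_min lexx.
have p2 : 2 * p <= p by lra.
exists (2 * p); first exact: le_trans p2 pp.
set c := phi (D * p) in phip *.
have h := @is_derive_ge0_le R (fun x => - ((- x) `^ b * (y x - c)))
  (fun x => - (b * (- x) `^ (b - 1) * (c - phi (D * x)))) (2 * p) p p2
  (fun x xp => isder_opp (@weighted_derive c x (le_lt_trans (proj2 (andP xp)) p0))).
have {}h : - ((- (2 * p)) `^ b * (y (2 * p) - c)) <= - ((- p) `^ b * (y p - c)).
  apply: h => x /andP[px xp]; rewrite oppr_ge0 mulr_ge0_le0//.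
  by rewrite subr_le0; apply: maximizer_le => //; rewrite ler_pM2l// ltW.
rewrite lerN2 in h.
have pn0 : 0 < - p by rewrite oppr_gt0.
have e : (- p) `^ b = (- (2 * p)) `^ b * th.
  rewrite /th -mulrN powRM// ?(ltW pn0)// mulrAC -powRD ?subrr ?powRr0 ?mul1r//.
  by rewrite pnatr_eq0 implybT.
rewrite e -mulrA ler_pM2l in h; last by rewrite powR_gt0 //; lra.
have yp0 : 0 <= y p by exact: le_trans yb_ge0 (dual_point_ge pp).
have hY : Y * (1 - th) <= c * (1 - th) by rewrite ler_pM2r// subr_gt0.
have eY : Y * (1 - th) = `|M| by rewrite /Y divfK// gt_eqF// subr_gt0.
have := ler_norm M; nra.
Qed.

Lemma dual_point_continuous p : p < 0 -> {for p, continuous y}.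
Proof. by move=> p0; exact: isder_cont (dual_derive2 dual p0). Qed.

Lemma dual_point_surj z : yb <= z -> exists2 p, p <= ps & y p = z.
Proof.
move=> yz; have [M Mp zM] := dual_point_unbounded z.
have [x /andP[_ xp]||x /andP[_ xp] xz] := @IVT_pointwise R y M ps z Mp.
- by apply: dual_point_continuous; rewrite (le_lt_trans xp).
- by right; rewrite dual_point_ps yz zM.
- by exists x.
Qed.

Let a := (1 - D)^-1.
(** The factor (- p)^(- a) is the integrating factor of the equation of w; along a
    costate path it is proportional to the discount factor exp(- rho t). *)
Definition gap (p : R) : R := (- p) `^ (- a) * (Fstar p - w p).

(** The linear equation of w cancels everything but the expression whose sign is
    prescribed by the threshold. *)
Let gap_derive (p : R) : p < 0 -> is_derive p (1:R) gap
  ((- p) `^ (- a) / ((D - 1) * p) *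
   ((D - 1) * p * phi p + Fstar p - Fstar (D * p) - m)).
Proof.
move=> p0; have pn0 : 0 < - p by rewrite oppr_gt0.
apply: (isder_eq (isder_mul (isder_powRN (- a) p0)
  (isder_add (Fstar_is_derive reg p) (isder_opp (dual_derive dual p0))))).
rewrite powRB ?(gt_eqF pn0) ?implybT// powRr1 ?(ltW pn0)// opprK.
have e := dual_ode dual p0.
have -> : Fstar (D * p) = (D - 1) * p * y p + w p - m by rewrite e; ring.
have aE : a = - (D - 1)^-1 by rewrite /a -invrN opprB.
rewrite {2}aE; field; by rewrite (gt_eqF D10) (lt_eqF p0).
Qed.

Lemma gap_ps : gap ps = 0.
Proof. by rewrite /gap (dual_boundary dual) subrr mulr0. Qed.

Lemma gap_incr p q : ps <= p -> p <= q -> q < 0 -> gap p <= gap q.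
Proof.
move=> pp pq q0; have h := @is_derive_ge0_le R _ _ p q pq (fun x xp => @gap_derive x
  (le_lt_trans (proj2 (andP xp)) q0)).
apply: h => x /andP[px xq]; have x0 := lt_trans xq q0.
rewrite mulr_le0//; last by apply: (stop_above thr); rewrite (le_trans pp)// ltW.
by rewrite mulr_ge0_le0 ?powR_ge0// invr_le0 ltW// pmulr_rlt0.
Qed.

Lemma gap_ge0 p : p < 0 -> 0 <= gap p.
Proof.
move=> p0; rewrite -gap_ps; have [pp|/ltW pp] := leP p ps; last exact: gap_incr.
rewrite -lerN2.
have h := @is_derive_ge0_le R (fun x => - gap x) _ p ps pp (fun x xp => isder_opp (@gap_derive x
  (le_lt_trans (proj2 (andP xp)) ps0))).
apply: h => x /andP[px xq]; have x0 := lt_trans xq ps0.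
rewrite oppr_ge0 mulr_le0_ge0//; last by apply: (continue_below thr); rewrite ltW.
by rewrite mulr_ge0_le0 ?powR_ge0// invr_le0 ltW// pmulr_rlt0.
Qed.

(** In the equation of w the term (D - 1) p y is nonpositive, since y >= yb >= 0. *)
Lemma dual_ge_Fstar p : p <= ps -> Fstar (D * p) + m <= w p.
Proof.
move=> pp; have p0 := le_lt_trans pp ps0.
rewrite -(dual_ode dual p0) gerDr nmulr_rle0.
  exact: le_trans yb_ge0 (dual_point_ge pp).
by rewrite pmulr_rlt0.
Qed.

End DualProperties.

(** * Weak duality and the optimal control *)

Section NonposIntegral.
Context {R : realType}.
Notation mu := (@lebesgue_measure R).

(** If f is not integrable its integral is -oo, since f <= 0. *)
Lemma le_integral_nonpos (A : set R) (f g : R -> R) : measurable A ->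
  measurable_fun A f -> (forall x, A x -> f x <= 0) -> (forall x, A x -> f x <= g x) ->
  mu.-integrable A (EFin \o g) ->
  (\int[mu]_(x in A) (f x)%R%:E <= \int[mu]_(x in A) (g x)%R%:E)%E.
Proof.
move=> mA mf f0 fg gi.
have mf' : measurable_fun A (EFin \o f) by exact/measurable_EFinP.
have [fi|fni] := pselect (mu.-integrable A (EFin \o f)).
  by apply: le_integral => // x; rewrite inE => /fg; rewrite lee_fin.
have -> : (\int[mu]_(x in A) (f x)%R%:E = - \int[mu]_(x in A) (- f x)%R%:E)%E.
  rewrite -integral_ge0N; last by move=> x /f0; rewrite lee_fin oppr_ge0.
  by apply: eq_integral => x _; rewrite /= opprK.
have -> : (\int[mu]_(x in A) (- f x)%R%:E = +oo)%E; last by rewrite leNye.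
apply/eqP; rewrite -leye_eq leNgt; apply/negP => lt; apply: fni.
apply/integrableP; split => //; apply: le_lt_trans lt.
rewrite le_eqVlt; apply/orP; left; apply/eqP; apply: eq_integral => x.
by rewrite inE => /f0 fx; rewrite /= ler0_norm.
Qed.

End NonposIntegral.

Section Control.
Context {R : realType}.
Variables (r rho m : R) (u : R -> R) (ps yb : R) (w y : R -> R).
Local Notation D := (delta r rho).
Hypotheses (r_gt0 : 0 < r) (rho_gt0 : 0 < rho) (m_gt0 : 0 < m) (reg : regular_cost u)
  (D1 : 1 < D) (thr : threshold D m u ps yb) (dual : dual_solution D m u ps w y).
Local Notation F := (F u).
Local Notation Fstar := (Fstar u).
Local Notation phi := (maximizer u).
Local Notation mu := (@lebesgue_measure R).
Local Notation gap := (gap D u w).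

Let D0 : 0 < D. Proof. exact: lt_trans D1. Qed.
Let ps0 : ps < 0. Proof. exact: ps_lt0 thr. Qed.
Let rE : r = D * rho. Proof. by rewrite /delta divfK// gt_eqF. Qed.
Let k : R := (D - 1) * rho.
Let k0 : 0 < k. Proof. by rewrite mulr_gt0// subr_gt0. Qed.

(** The adjoint state: along the optimal trajectory it is the derivative of the
    value function. Its rate is - k = rho - r whatever the trajectory. *)
Definition costate (q0 t : R) : R := q0 * expR (- k * t).
Local Notation q := costate.

Lemma costate_lt0 q0 t : q0 < 0 -> q q0 t < 0.
Proof. by move=> h; rewrite /costate pmulr_llt0// expR_gt0. Qed.

Lemma costate0 q0 : q q0 0 = q0.
Proof. by rewrite /costate mulr0 expR0 mulr1. Qed.

Lemma costate_le q0 s t : q0 < 0 -> s <= t -> q q0 s <= q q0 t.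
Proof.
move=> h st; rewrite /costate ler_nM2l// ler_expR !mulNr lerN2.
by rewrite ler_wpM2l// ltW.
Qed.

Lemma costate_lt q0 s t : q0 < 0 -> s < t -> q q0 s < q q0 t.
Proof.
move=> h st; rewrite /costate ltr_nM2l// ltr_expR !mulNr ltrN2.
by rewrite ltr_pM2l.
Qed.

Lemma is_derive_expRM (c t : R) : is_derive t (1:R) (fun s : R => expR (c * s)) (c * expR (c * t)).
Proof.
apply: (isder_eq (isder_comp (isder_scale c (isder_id t)) (is_derive_expR _))).
by rewrite mulr1 mulrC.
Qed.

Lemma costate_is_derive q0 t : is_derive t (1:R) (q q0) (- k * q q0 t).
Proof.
apply: (isder_eq (isder_scale q0 (is_derive_expRM (- k) t))).
by rewrite /costate; ring.
Qed.

Lemma costate_continuous q0 : continuous (q q0).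
Proof. by move=> t; exact: isder_cont (costate_is_derive q0 t). Qed.

Lemma discount_continuous (c : R) : continuous (fun t : R => expR (c * t)).
Proof. by move=> t; exact: isder_cont (is_derive_expRM c t). Qed.

Lemma costate_comp_continuous (g : R -> R) q0 : (forall p, p < 0 -> {for p, continuous g}) ->
  q0 < 0 -> continuous (fun t => g (q q0 t)).
Proof.
move=> cg h t; apply: continuous_comp; first exact: costate_continuous.
by apply: cg; exact: costate_lt0.
Qed.

Let Fstar_scaled_continuous (p : R) : {for p, continuous (fun p : R => Fstar (D * p))}.
Proof.
apply: (@continuous_comp _ _ _ (fun p : R => D * p) Fstar); last exact: Fstar_continuous.
exact: isder_cont (isder_scale D (isder_id p)).
Qed.

Let phi_scaled_continuous (p : R) : {for p, continuous (fun p : R => phi (D * p))}.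
Proof.
apply: (@continuous_comp _ _ _ (fun p : R => D * p) phi); last exact: maximizer_continuous.
exact: isder_cont (isder_scale D (isder_id p)).
Qed.

Lemma discounted_dual (q0 T : R) : q0 < 0 -> 0 <= T ->
  (\int[mu]_(t in `[0%R, T]) (rho * expR (- rho * t) * (Fstar (D * q q0 t) + m))%R%:E =
   (w q0 - expR (- rho * T) * w (q q0 T))%R%:E)%E.
Proof.
move=> h T0.
have c : continuous (fun t => rho * expR (- rho * t) * (Fstar (D * q q0 t) + m)).
  move=> t; apply: cvgM.
    by apply: cvgM; [exact: cvg_cst|exact: discount_continuous].
  apply: cvgD; last exact: cvg_cst.
  by apply: (costate_comp_continuous (g := fun p => Fstar (D * p))).
have d (t : R) : is_derive t (1:R) (fun t => - (expR (- rho * t) * w (q q0 t)))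
    (rho * expR (- rho * t) * (Fstar (D * q q0 t) + m)).
  have qt := costate_lt0 t h.
  (* along the costate, the derivative of the discounted w is - rho exp(- rho t) times the
     left-hand side of the equation of w *)
  apply: (isder_eq (isder_opp (isder_mul (is_derive_expRM (- rho) t)
    (isder_comp (costate_is_derive q0 t) (dual_derive dual qt))))).
  by rewrite -(dual_ode dual qt) /k; ring.
rewrite (FTC2 T0 c d) costate0 mulr0 expR0; congr (_%:E); ring.
Qed.

Lemma discounted_gap (q0 T : R) : q0 < 0 ->
  expR (- rho * T) * (Fstar (q q0 T) - w (q q0 T)) = (- q0) `^ ((1 - D)^-1) * gap (q q0 T).
Proof.
move=> h; rewrite /gap mulrA; congr (_ * _).
have qn0 : 0 < - q0 by rewrite oppr_gt0.
rewrite /costate -[- (q0 * _)]mulNr powRM ?expR_ge0 ?(ltW qn0)// mulrA -powRD ?(gt_eqF qn0) ?implybT//.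
rewrite subrr powRr0 mul1r -expRM; congr expR.
rewrite /k; field; rewrite -oppr_eq0 opprB gt_eqF// subr_gt0//.
Qed.

Let cost_measurable (A : set R) (p : R -> R) : measurable A -> measurable_fun A p ->
  (forall t, A t -> 0 <= p t) -> measurable_fun A (running_value rho m u p).
Proof.
move=> mA mp p0.
apply: (@eq_measurable_fun _ _ _ _ A
  (fun t => rho * expR (- rho * t) * (- m + F (Num.max (p t) 0)))).
  by move=> t; rewrite inE => /p0 pt; rewrite /running_value max_l.
apply: measurable_funM.
  apply: measurable_funTS; apply: continuous_measurable_fun => t.
  by apply: cvgM; [exact: cvg_cst|exact: discount_continuous].
apply: measurable_funD; first exact: measurable_cst.
apply: (measurableT_comp (f := fun z : R => F (Num.max z 0))) => //.
by apply: continuous_measurable_fun; exact: cost_max_continuous.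
Qed.

Let running_le0 (p : R -> R) t : 0 <= p t -> running_value rho m u p t <= 0.
Proof.
move=> /(cost_le0 reg) h; rewrite mulr_ge0_le0 ?mulr_ge0 ?expR_ge0 ?(ltW rho_gt0)//.
by have := m_gt0; lra.
Qed.

(** Fenchel's inequality F p <= D q p - Fstar (D q) bounds the running reward by a
    deterministic part, integrated by discounted_dual, and a part linear in the
    control, integrated by discounted_ode. The latter produces - q z(T) at the
    final time, which offsets the terminal reward up to Fstar (q T). The state has
    disappeared from the bound. *)
Lemma weak_duality_finite (y0 q0 T : R) (p z : R -> R) : q0 < 0 -> 0 <= T ->
  measurable_fun `[0 : R, +oo[ p -> (forall t, 0 <= t -> 0 <= p t) ->
  trajectory r y0 p z -> 0 <= z T ->
  (\int[mu]_(t in `[0%R, T]) (running_value rho m u p t)%R%:E + (terminal_value rho u z T)%R%:E <=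
   (q0 * y0 - w q0 - (- q0) `^ ((1 - D)^-1) * gap (q q0 T))%R%:E)%E.
Proof.
move=> h T0 mp p0 traj zT.
have [pint pE] := discounted_ode r_gt0 T0 traj.
pose g1 t := rho * expR (- rho * t) * (Fstar (D * q q0 t) + m).
pose g2 t := r * expR (- r * t) * p t.
have cg1 : continuous g1.
  move=> t; apply: cvgM.
    by apply: cvgM; [exact: cvg_cst|exact: discount_continuous].
  apply: cvgD; last exact: cvg_cst.
  by apply: (costate_comp_continuous (g := fun p => Fstar (D * p))).
have g1i := continuous_integrable 0 T cg1.
have gi : mu.-integrable `[0%R, T] (EFin \o (fun t => q0 * g2 t - g1 t)).
  by apply: integrable_sub => //; exact: integrable_scale.
have sub : `[0%R, T] `<=` `[0 : R, +oo[.
  by move=> t; rewrite /= !in_itv/= => /andP[->].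
have mp' : measurable_fun `[0%R, T] p by exact: measurable_funS mp.
have p0' t : `[0%R, T]%classic t -> 0 <= p t.
  by rewrite /= in_itv/= => /andP[/p0].
have le1 : (\int[mu]_(t in `[0%R, T]) (running_value rho m u p t)%R%:E <=
    \int[mu]_(t in `[0%R, T]) (q0 * g2 t - g1 t)%R%:E)%E.
  apply: le_integral_nonpos => //.
  - exact: cost_measurable.
  - by move=> t /p0'; exact: running_le0.
  - move=> t /p0' pt; rewrite /g1 /g2 /running_value.
    have -> : expR (- r * t) = expR (- rho * t) * expR (- k * t).
      by rewrite -expRD rE /k; congr expR; ring.
    (* D stands for r / rho, so only the factor r outside D is to be expanded *)
    have -> : q0 * (r * (expR (- rho * t) * expR (- k * t)) * p t) =
        rho * expR (- rho * t) * (D * q q0 t * p t).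
      by rewrite [X in q0 * (X * _ * _)]rE /costate; ring.
    rewrite -mulrBr ler_pM2l ?mulr_gt0 ?expR_gt0//.
    by have := Fstar_le reg (D * q q0 t) pt; lra.
apply: (le_trans (leeD le1 (lexx _))).
have -> : (\int[mu]_(t in `[0%R, T]) (q0 * g2 t - g1 t)%R%:E =
   (q0 * (y0 - expR (- r * T) * z T) - (w q0 - expR (- rho * T) * w (q q0 T)))%R%:E)%E.
  have e2 : (\int[mu]_(t in `[0%R, T]) (q0 * g2 t)%R%:E = (q0 * (y0 - expR (- r * T) * z T))%R%:E)%E.
    rewrite -pE; under eq_integral do rewrite EFinM.
    rewrite integralZl// EFinM; congr (_ * _)%E.
    by rewrite /Rintegral fineK//; exact: integrable_fin_num.
  under eq_integral do rewrite EFinB.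
  rewrite integralB//; last exact: (integrable_scale q0 pint).
  by rewrite e2 discounted_dual.
rewrite -EFinD lee_fin -discounted_gap// /terminal_value.
have -> : expR (- r * T) = expR (- rho * T) * expR (- k * T).
  by rewrite -expRD rE /k; congr expR; ring.
have Fz := Fstar_le reg (q q0 T) zT.
have e0 : 0 < expR (- rho * T) by exact: expR_gt0.
rewrite -subr_ge0.
have -> : q0 * y0 - w q0 - expR (- rho * T) * (Fstar (q q0 T) - w (q q0 T)) -
  (q0 * (y0 - expR (- rho * T) * expR (- k * T) * z T) -
    (w q0 - expR (- rho * T) * w (q q0 T)) + expR (- rho * T) * F (z T)) =
  expR (- rho * T) * (z T * q q0 T - F (z T) - Fstar (q q0 T)).
  by rewrite /costate; ring.
by rewrite mulr_ge0 ?(ltW e0)// subr_ge0.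
Qed.

(** The conjugate of the value function on the whole negative axis: stopping is
    optimal for costates above ps. *)
Definition value_dual (q0 : R) : R := if q0 <= ps then w q0 else Fstar q0.

(** For q0 <= ps this is gap >= 0; for q0 > ps the costate increases within the
    region where gap increases. *)
Lemma value_dual_le (q0 T : R) : q0 < 0 -> 0 <= T ->
  value_dual q0 <= w q0 + (- q0) `^ ((1 - D)^-1) * gap (q q0 T).
Proof.
move=> h T0; rewrite /value_dual; have qT := costate_lt0 T h; case: ifPn => qp.
  by rewrite lerDl mulr_ge0 ?powR_ge0//; exact: (gap_ge0 reg D1 thr dual qT).
have := discounted_gap 0 h; rewrite mulr0 expR0 mul1r costate0 => e.
rewrite -ltNge in qp.
have := gap_incr reg D1 thr dual (ltW qp) (_ : q0 <= q q0 T) qT.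
rewrite -{1}(costate0 q0) costate_le// => /(_ isT) g.
rewrite -lerBlDl e ler_wpM2l// powR_ge0//.
Qed.

(** Otherwise the continuous path z would take a negative value before T. *)
Lemma trajectory_hitting_ge0 (y0 T : R) (p z : R -> R) : 0 <= y0 -> 0 <= T ->
  trajectory r y0 p z -> (T%:E <= hitting_time z)%E -> 0 <= z T.
Proof.
move=> y00 T0 traj hit; rewrite leNgt; apply/negP => zT.
have cz := caratheodory_continuous T0 traj.
have z0 : z 0 = y0.
  by have [_ ->] := traj 0 (lexx 0); rewrite set_itv1 Rintegral_set1 addr0.
have [|c] := @IVT R z 0 T (z T / 2) T0 cz.
  rewrite z0; apply/andP; split.
    by rewrite ge_min; apply/orP; right; lra.
  by rewrite le_max; apply/orP; left; lra.
rewrite in_itv/= => /andP[c_ge0 cT] e.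
have {}cT : c < T.
  by rewrite lt_neqAle cT andbT; apply/eqP => cT'; move: e; rewrite cT'; lra.
have : (hitting_time z <= c%:E)%E.
  by apply: ereal_inf_lbound; exists c => //; split=> //; rewrite e; lra.
by move=> /(le_trans hit); rewrite lee_fin leNgt cT.
Qed.

(** For T = +oo the running reward, being nonpositive, only decreases when the
    horizon grows, so the bounds for finite horizons pass to the limit as the
    terminal reward vanishes. *)
Lemma weak_duality (y0 q0 : R) : 0 <= y0 -> q0 < 0 ->
  (Fbar r rho m u y0 <= (q0 * y0 - value_dual q0)%R%:E)%E.
Proof.
move=> y00 h; apply: ge_ereal_sup => _ [p [z [T [[mp p0 traj /andP[T0 hit] inf] ->]]]].
have fin (t : R) : 0 <= t -> (t%:E <= hitting_time z)%E ->
   (\int[mu]_(s in `[0%R, t]) (running_value rho m u p s)%R%:E + (terminal_value rho u z t)%R%:E <=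
    (q0 * y0 - value_dual q0)%R%:E)%E.
  move=> t0 ht; have zt := trajectory_hitting_ge0 y00 t0 traj ht.
  apply: (le_trans (weak_duality_finite h t0 mp p0 traj zt)).
  by rewrite lee_fin; have := value_dual_le h t0; lra.
case: T T0 hit inf => [T|_|]//.
  rewrite lee_fin => T0 hit _; rewrite /payoff addeC.
  rewrite (_ : [set t : R | _] = `[0%R, T]%classic); first exact: fin.
  by apply/seteqP; split=> t /=; rewrite in_itv/= lee_fin; [move=> [-> ->]|move/andP].
move=> hit /(_ erefl) lim; rewrite /payoff add0e.
rewrite (_ : [set t : R | _] = `[0%R, +oo[%classic); last first.
  by apply/seteqP; split=> t /=; rewrite in_itv/= leey andbT; [move=> []|].
set I := (\int[mu]_(t in _) _)%E.
have hI (t : R) : 0 <= t -> (I + (terminal_value rho u z t)%R%:E <= (q0 * y0 - value_dual q0)%R%:E)%E.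
  move=> t0; apply: (le_trans _ (fin t t0 _)); last exact: le_trans (leey _) hit.
  apply: leeD => //.
  have neg (A : set R) : A `<=` `[0%R, +oo[%classic ->
    (\int[mu]_(s in A) (running_value rho m u p s)%R%:E =
     - \int[mu]_(s in A) (- running_value rho m u p s)%R%:E)%E.
    move=> sA; rewrite -integral_ge0N.
      by apply: eq_integral => x _; rewrite /= opprK.
    move=> x /sA; rewrite /= in_itv/= andbT => /p0 px.
    by rewrite lee_fin oppr_ge0 running_le0.
  rewrite /I !neg//; last by move=> s; rewrite /= !in_itv/= => /andP[->].
  rewrite leeN2; apply: ge0_subset_integral => //.
  - apply/measurable_EFinP; apply: measurableT_comp => //.
    by apply: cost_measurable => // s; rewrite /= in_itv/= andbT => /p0.
  - by move=> s; rewrite /= in_itv/= andbT => /p0 ps'; rewrite lee_fin oppr_ge0 running_le0.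
  - by move=> s; rewrite /= !in_itv/= => /andP[->].
have I0 : (I <= (q0 * y0 - value_dual q0 - terminal_value rho u z 0)%R%:E)%E.
  by rewrite EFinB leeBrDr//; exact: hI.
case: I I0 hI => [i _ hI|//|_ _]; last by rewrite leNye.
rewrite lee_fin; apply/ler_addgt0Pr => e e0.
move/cvgrPdist_le : lim => /(_ e e0)[M [_ HM]].
have Mt : M < Num.max M 0 + 1 by rewrite (@le_lt_trans _ _ (Num.max M 0)) ?ltrDl// le_max lexx.
have t0 : 0 <= Num.max M 0 + 1 by rewrite addr_ge0// le_max lexx orbT.
have := HM _ Mt; rewrite /= sub0r normrN ler_norml => /andP[h1 _].
by have := hI _ t0; rewrite -EFinD lee_fin; lra.
Qed.

(** The candidate optimal pair. It solves the state equation for all times, also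
    after the costate has reached ps, where the path may become negative. *)
Let ctrl q0 t := phi (D * q q0 t).
Let path q0 t := y (q q0 t).

Let path_is_derive q0 t : q0 < 0 ->
  is_derive t (1:R) (path q0) (r * (path q0 t - ctrl q0 t)).
Proof.
move=> h; have qt := costate_lt0 t h.
apply: (isder_eq (isder_comp (costate_is_derive q0 t) (dual_derive2 dual qt))).
rewrite [X in _ = X * _]rE /path /ctrl /k; field.
by rewrite (lt_eqF qt) gt_eqF// subr_gt0.
Qed.

Let path_continuous q0 : q0 < 0 -> continuous (path q0).
Proof. by move=> h t; exact: isder_cont (path_is_derive t h). Qed.

Let ctrl_continuous q0 : q0 < 0 -> continuous (ctrl q0).
Proof. by move=> h; apply: (costate_comp_continuous (g := fun p => phi (D * p))). Qed.

Let path_trajectory q0 : q0 < 0 -> trajectory r (y q0) (ctrl q0) (path q0).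
Proof.
move=> h t t0.
have c : continuous (fun s => r * (path q0 s - ctrl q0 s)).
  move=> s; apply: cvgM; first exact: cvg_cst.
  by apply: cvgB; [exact: path_continuous|exact: ctrl_continuous].
split; first exact: continuous_integrable.
rewrite /Rintegral (FTC2 t0 c (fun s => path_is_derive s h))/=.
by rewrite /path costate0 addrC subrK.
Qed.

(** Equality in Fenchel's inequality turns the running reward into an exact
    derivative: that of minus the discounted value p y - w. *)
Let path_running q0 t : q0 < 0 ->
  is_derive t (1:R)
    (fun t => - (expR (- rho * t) * (q q0 t * y (q q0 t) - w (q q0 t))))
    (running_value rho m u (ctrl q0) t).
Proof.
move=> h; have qt := costate_lt0 t h.
have d1 := isder_mul (costate_is_derive q0 t) (path_is_derive t h).
have d2 := isder_comp (costate_is_derive q0 t) (dual_derive dual qt).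
apply: (isder_eq (isder_opp (isder_mul (is_derive_expRM (- rho) t)
  (isder_add d1 (isder_opp d2))))).
rewrite /running_value /path /ctrl.
have -> : F (phi (D * q q0 t)) = D * q q0 t * phi (D * q q0 t) - Fstar (D * q q0 t).
  by rewrite FstarE//; ring.
have -> : Fstar (D * q q0 t) = (D - 1) * q q0 t * y (q q0 t) + w (q q0 t) - m.
  by rewrite (dual_ode dual qt); ring.
rewrite [X in q q0 t * (X * _)]rE /k; ring.
Qed.

Let path_running_continuous q0 : q0 < 0 -> continuous (running_value rho m u (ctrl q0)).
Proof.
move=> h.
have -> : running_value rho m u (ctrl q0) = (fun t => rho * expR (- rho * t) *
    (- m + (ctrl q0 t * (D * q q0 t) - Fstar (D * q q0 t)))).
  by apply/funext => t; rewrite /running_value /ctrl FstarE//; congr (_ * (_ + _)); ring.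
move=> t; apply: cvgM.
  by apply: cvgM; [exact: cvg_cst|exact: discount_continuous].
apply: cvgD; first exact: cvg_cst.
apply: cvgB.
  apply: cvgM; first exact: ctrl_continuous.
  by apply: cvgM; [exact: cvg_cst|exact: costate_continuous].
by apply: (costate_comp_continuous (g := fun p => Fstar (D * p))).
Qed.

(** The pair is stopped when the costate reaches ps, that is when the path reaches
    yb; the exact derivative then integrates to the upper bound of weak duality. *)
Lemma attainment q0 : q0 <= ps ->
  ((q0 * y q0 - w q0)%R%:E <= Fbar r rho m u (y q0))%E.
Proof.
move=> qp; have h := le_lt_trans qp ps0.
(* the time at which the costate equals ps *)
pose T := ln (q0 / ps) / k.
have qps : 1 <= q0 / ps by rewrite ler_ndivlMr// mul1r.
have T0 : 0 <= T by rewrite divr_ge0// ?ln_ge0// ltW.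
have qT : q q0 T = ps.
  rewrite /costate (_ : - k * T = - ln (q0 / ps)); last first.
    by rewrite /T mulNr mulrC divfK// gt_eqF.
  rewrite expRN lnK ?posrE ?(lt_le_trans ltr01)//.
  by rewrite invf_div mulrC divfK// lt_eqF.
have yps := dual_point_ps D1 thr dual.
have hit : (T%:E <= hitting_time (path q0))%E.
  apply: le_ereal_inf_tmp => _ [t [t0 yt] <-]; rewrite lee_fin leNgt; apply/negP => tT.
  have := dual_point_decr reg D1 thr dual (_ : q q0 t < ps) (lexx ps).
  rewrite -{1}qT (costate_lt h tT) => /(_ isT); rewrite yps.
  by move: yt; rewrite /path => yt /(lt_le_trans)/(_ yt); rewrite ltNge (yb_ge0 reg thr).
apply: ereal_sup_ubound; exists (ctrl q0), (path q0), T%:E; split.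
  split=> //.
  - apply: measurable_funTS; apply: continuous_measurable_fun.
    exact: ctrl_continuous.
  - by move=> t _; exact: maximizer_ge0.
  - exact: path_trajectory.
  - by rewrite lee_fin T0.
rewrite /payoff (_ : [set t : R | _] = `[0%R, T]%classic); last first.
  by apply/seteqP; split=> t /=; rewrite in_itv/= lee_fin; [move=> [-> ->]|move/andP].
rewrite (FTC2 T0 (path_running_continuous h) (fun t => path_running t h)).
rewrite /terminal_value /path qT yps -EFinD costate0 mulr0 expR0 (dual_boundary dual).
rewrite (FstarE reg ps) (maximizer_ps thr); congr (_%:E); ring.
Qed.

Lemma stopping_attainment y0 : 0 <= y0 -> ((F y0)%:E <= Fbar r rho m u y0)%E.
Proof.
move=> y00; apply: ereal_sup_ubound; exists (fun=> y0), (fun=> y0), (0%R)%:E; split.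
  split=> //.
  - move=> t t0; split.
      by apply: continuous_integrable => s; exact: cvg_cst.
    by rewrite subrr mulr0 Rintegral_cst// mul0r addr0.
  - rewrite lexx/=; apply: le_ereal_inf_tmp => _ [t [t0 _] <-]; by rewrite lee_fin.
rewrite /payoff (_ : [set t : R | _] = [set 0%R]); last first.
  apply/seteqP; split=> t /=; rewrite lee_fin; last by move=> ->.
  by move=> [t0 t0']; apply/eqP; rewrite eq_le t0 t0'.
by rewrite integral_set1 adde0 /terminal_value mulr0 expR0 mul1r.
Qed.

Lemma value_continuation q0 : q0 <= ps ->
  Fbar r rho m u (y q0) = (q0 * y q0 - w q0)%R%:E.
Proof.
move=> qp; apply/eqP; rewrite eq_le attainment// andbT.
have h := le_lt_trans qp ps0.
have y00 : 0 <= y q0 by exact: le_trans (yb_ge0 reg thr) (dual_point_ge reg D1 thr dual qp).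
by have := weak_duality y00 h; rewrite /value_dual qp.
Qed.

(** The costate F' y0 makes the bound of weak duality equal to F y0. *)
Lemma value_stopping y0 : 0 <= y0 -> y0 <= yb -> ps <= F' u 0 ->
  Fbar r rho m u y0 = (F y0)%:E.
Proof.
move=> y00 yy pF; apply/eqP; rewrite eq_le stopping_attainment// andbT.
have h := cost_deriv_lt0 reg y00.
apply: (le_trans (weak_duality y00 h)); rewrite lee_fin.
have -> : value_dual (F' u y0) = Fstar (F' u y0).
  rewrite /value_dual; case: ifPn => // hp.
  have pE : F' u y0 = ps.
    apply/eqP; rewrite eq_le hp -[ps](maximizerP reg pF).2 (maximizer_ps thr).
    exact: cost_deriv_le.
  by rewrite pE (dual_boundary dual).
by rewrite FstarE// maximizer_cost_deriv//; lra.
Qed.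

End Control.

(** * Regularity and growth of the value function *)

Section Envelope.
Context {R : realType}.
Variables V Q : R -> R.
Hypotheses (super : forall x z, 0 <= x -> 0 <= z -> V z <= V x + Q x * (z - x))
  (Q_decr : decreasing_Rp Q).

(** Passing through the midpoint h, the supergradient at h is strictly between
    those at x and z. *)
Lemma supergradient_decr_lt x z : 0 <= x -> 0 <= z -> z != x -> V z < V x + Q x * (z - x).
Proof.
move=> x0 z0 zx; pose h := (x + z) / 2.
have h0 : 0 <= h by rewrite /h; lra.
have s1 := super x0 h0; have s2 := super h0 z0.
have [xz|xz] : x < z \/ z < x by apply/orP; rewrite -neq_lt eq_sym.
  have xh : x < h by rewrite /h; lra.
  have hz : 0 < z - h by rewrite /h; lra.
  have := Q_decr x0 xh; rewrite -(ltr_pM2r hz) => ?; lra.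
have xh : h < x by rewrite /h; lra.
have hz : z - h < 0 by rewrite /h; lra.
have := Q_decr h0 xh; rewrite -(ltr_nM2r hz) => ?; lra.
Qed.

Lemma supergradient_decr_concave : strictly_concave_Rp V.
Proof.
move=> x z t x0 xz t0 t1; have z0 : 0 <= z by rewrite (le_trans x0)// ltW.
set c := t * x + (1 - t) * z.
have xc : x - c = (1 - t) * (x - z) by rewrite /c; ring.
have zc : z - c = t * (z - x) by rewrite /c; ring.
have c0 : 0 <= c by rewrite addr_ge0// mulr_ge0// ?subr_ge0 ltW.
have xnc : x != c.
  by rewrite -subr_eq0 xc lt_eqF// pmulr_rlt0 ?subr_gt0// subr_lt0.
have znc : z != c.
  by rewrite -subr_eq0 zc gt_eqF// mulr_gt0// subr_gt0.
have := supergradient_decr_lt c0 x0 xnc; have := supergradient_decr_lt c0 z0 znc.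
have t1' : 0 < 1 - t by rewrite subr_gt0.
rewrite zc xc -(ltr_pM2l t1') => h1; rewrite -(ltr_pM2l t0) => h2; lra.
Qed.

Hypothesis Q_lt0 : forall z, 0 <= z -> Q z < 0.

Lemma supergradient_decr_decreasing : decreasing_Rp V.
Proof.
move=> x z x0 xz; have z0 : 0 <= z by rewrite (le_trans x0)// ltW.
rewrite (le_lt_trans (super x0 z0))// gtrDl nmulr_rlt0 ?subr_gt0//; exact: Q_lt0.
Qed.

Hypothesis Q_surj : forall v, v <= Q 0 -> exists2 z, 0 <= z & Q z = v.

Lemma supergradient_decr_C1 : C1_Rp V /\ deriv_Rp V 0 = Q 0.
Proof.
have m0 := @max0_ge0 R.
have Q_le x z : 0 <= x -> x <= z -> Q z <= Q x.
  move=> x0; rewrite le_eqVlt => /orP[/eqP ->//|xz]; exact: ltW (Q_decr x0 xz).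
have cQ : continuous (fun z : R => Q (Num.max z 0)).
  apply: nonincreasing_continuous => [x z xz|x z v xz].
    by apply: (Q_le _ _ (m0 x)); rewrite ge_max !le_max xz lexx orbT.
  move=> /andP[_ vx]; have [|t t0 tv] := @Q_surj v.
    by rewrite (le_trans (ltW vx))// Q_le.
  by exists t; rewrite max_l.
have d x : 0 <= x -> derivable_Rp V x /\ deriv_Rp V x = Q x.
  move=> x0; apply: (@supergradient_Rp _ V Q x x0 _ (cQ x)) => z z0.
  by split; exact: super.
split; last by have [] := d 0 (lexx 0).
split; first by move=> x /d[].
apply/continuous_Rp; rewrite (_ : (fun z : R => _) = (fun z : R => Q (Num.max z 0)))//.
by apply/funext => z; have [] := d _ (m0 z).
Qed.

End Envelope.

Section PowerGrowth.
Context {R : realType}.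

(** For z <= 1 the bound is nonnegative. On [1, Z] a small d suffices as V <= V 1 < 0,
    and beyond Z the hypothesis gives V z <= - (kappa z)^gamma / 2. *)
Lemma power_growth_upper (V : R -> R) (gamma kappa Y : R) : 0 < gamma -> 0 < kappa ->
  decreasing_Rp V -> V 0 <= 0 ->
  (forall z, 0 <= z -> Y <= z -> V z <= 1 - (kappa * z) `^ gamma) ->
  exists2 d, 0 < d & forall z, 0 <= z -> V z <= d * (1 - z `^ gamma).
Proof.
move=> gamma0 kappa0 decr V0 VY.
have mono a b := @ler_powR_nneg R gamma a b (ltW gamma0).
have V1 : V 1 < 0 by exact: lt_le_trans (decr 0 1 (lexx 0) ltr01) V0.
have Vle x z : 0 <= x -> x <= z -> V z <= V x.
  move=> x0; rewrite le_eqVlt => /orP[/eqP ->//|xz]; exact: ltW (decr _ _ x0 xz).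
pose Z := Num.max 1 (Num.max Y (2 `^ gamma^-1 / kappa)).
have Z1 : 1 <= Z by rewrite /Z le_max lexx.
have ZY : Y <= Z by rewrite /Z !le_max lexx !orbT.
have Zk : 2 `^ gamma^-1 <= kappa * Z.
  by rewrite mulrC -ler_pdivrMr// /Z !le_max lexx !orbT.
have Z0 : 0 < Z by exact: lt_le_trans Z1.
have ZZ0 : 0 < Z `^ gamma by exact: powR_gt0.
pose d := Num.min (- V 1 / Z `^ gamma) (kappa `^ gamma / 2).
have d0 : 0 < d by rewrite /d lt_min !divr_gt0 ?powR_gt0// oppr_gt0.
have d1 : d * Z `^ gamma <= - V 1 by rewrite -ler_pdivlMr// /d ge_min lexx.
have d2 : d <= kappa `^ gamma / 2 by rewrite /d ge_min lexx orbT.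
exists d => // z z0; have [z1|z1] := leP z 1.
  have zg : z `^ gamma <= 1 by have := mono _ _ z0 z1; rewrite powR1.
  apply: (@le_trans _ _ 0); first exact: le_trans (Vle _ _ (lexx 0) z0) V0.
  by rewrite mulr_ge0 ?subr_ge0 ?(ltW d0).
have [zZ|/ltW Zz] := leP z Z.
  have h := Vle _ _ ler01 (ltW z1).
  have := mono _ _ z0 zZ; rewrite -(ler_pM2l d0) => ?; lra.
apply: (le_trans (VY z z0 (le_trans ZY Zz))).
have kz : 2 <= (kappa * z) `^ gamma.
  have h : 2 `^ gamma^-1 <= kappa * z by rewrite (le_trans Zk)// ler_pM2l.
  by have := mono _ _ (powR_ge0 _ _) h; rewrite -powRrM mulVf ?gt_eqF// powRr1.
have kE : (kappa * z) `^ gamma = kappa `^ gamma * z `^ gamma by rewrite powRM// ltW.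
have zg := powR_ge0 z gamma.
have := ler_wpM2r zg d2; rewrite kE in kz *; lra.
Qed.

End PowerGrowth.

Section Value.
Context {R : realType}.
Variables (r rho m : R) (u : R -> R).
Local Notation D := (delta r rho).
Hypotheses (r_gt0 : 0 < r) (rho_gt0 : 0 < rho) (m_gt0 : 0 < m) (reg : regular_cost u)
  (D1 : 1 < D) (Fdm_decr : decreasing_Rp (Fdm r rho m u))
  (Fdm_cvg : Fdm r rho m u y @[y --> +oo] --> -oo).
Local Notation F := (F u).
Local Notation F' := (F' u).
Local Notation Fstar := (Fstar u).
Local Notation phi := (maximizer u).
Local Notation ps := (pstar r rho m u).
Local Notation yb := (ybar r rho m u).
Local Notation small := (small_m r rho m u).
Local Notation Fbar := (Fbar r rho m u).

Variables w y : R -> R.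
Hypotheses (dual : dual_solution D m u ps w y)
  (wE : forall p, p <= ps -> wstar r rho m u p = w p).

Let thr := threshold_pstar reg m_gt0 D1 Fdm_decr Fdm_cvg.
Let ps0 : ps < 0. Proof. exact: ps_lt0 thr. Qed.
Let yb0 : 0 <= yb. Proof. exact: ybar_ge0. Qed.

(** Weak duality over all p <= ps, with equality at the p such that y p = z. *)
Lemma Fbar_conj z : yb <= z -> Fbar z = wstar_conj r rho m u z.
Proof.
move=> yz; have z0 := le_trans yb0 yz.
apply/eqP; rewrite eq_le; apply/andP; split.
  apply: le_ereal_inf_tmp => _ [p /= /[!in_itv]/= pp <-].
  have := weak_duality r_gt0 rho_gt0 m_gt0 reg D1 thr dual z0 (le_lt_trans pp ps0).
  by rewrite /value_dual pp wE// (mulrC p).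
have [p pp <-] := dual_point_surj reg D1 thr dual yz.
rewrite (value_continuation r_gt0 rho_gt0 m_gt0 reg D1 thr dual pp).
apply: ereal_inf_lbound; exists p; first by rewrite /= in_itv.
by rewrite wE// mulrC.
Qed.

Lemma large_of_lt_ybar z : 0 <= z -> z < yb -> ps = F' yb.
Proof.
move=> z0 zy; have [s|s] := boolP small.
  by move: zy; rewrite (ybar_small reg s) ltNge z0.
by have [] := threshold_large reg D1 Fdm_decr Fdm_cvg s.
Qed.

Lemma Fbar_stop z : ~~ small -> 0 <= z -> z <= yb -> Fbar z = (F z)%:E.
Proof.
move=> s z0 zy; apply: (value_stopping r_gt0 rho_gt0 m_gt0 reg D1 thr dual z0 zy).
have [-> _] := threshold_large reg D1 Fdm_decr Fdm_cvg s.
exact: cost_deriv_le.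
Qed.

(** The derivative of the value function, i.e. the costate at which z is optimal. *)
Let slope z := if z < yb then F' z else xget 0 [set p | p <= ps /\ y p = z].

Let slopeP z : yb <= z -> slope z <= ps /\ y (slope z) = z.
Proof.
move=> yz; rewrite /slope ltNge yz/=.
have [p pp pz] := dual_point_surj reg D1 thr dual yz.
by apply: (@xgetPex R 0 [set p | p <= ps /\ y p = z]); exists p.
Qed.

Let slope_dual p : p <= ps -> slope (y p) = p.
Proof.
move=> pp; have [sp sy] := slopeP (dual_point_ge reg D1 thr dual pp).
case: (ltgtP (slope (y p)) p) => // h.
  by have := dual_point_decr reg D1 thr dual h pp; rewrite sy ltxx.
by have := dual_point_decr reg D1 thr dual h sp; rewrite sy ltxx.
Qed.

Let slope_lt0 z : 0 <= z -> slope z < 0.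
Proof.
move=> z0; have [/slopeP[h _]|h] := leP yb z; first exact: le_lt_trans h ps0.
by rewrite /slope h; exact: (cost_deriv_lt0 reg).
Qed.

Let slope_decr : decreasing_Rp slope.
Proof.
move=> x z x0 xz; have [h|h] := leP yb x.
  have [sx yx] := slopeP h; have [sz yz] := slopeP (le_trans h (ltW xz)).
  rewrite ltNge; apply/negP; rewrite le_eqVlt => /orP[/eqP e|e].
    by move: xz; rewrite -yx -yz e ltxx.
  by have := dual_point_decr reg D1 thr dual e sz; rewrite yx yz ltNge ltW.
have pE := large_of_lt_ybar x0 h; rewrite {2}/slope h.
have [h'|h'] := leP yb z; last by rewrite /slope h'; exact: (cost_deriv_decr reg).
have [sz _] := slopeP h'; rewrite (le_lt_trans sz)// pE.
exact: (cost_deriv_decr reg).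
Qed.

Let slope_surj v : v <= slope 0 -> exists2 z, 0 <= z & slope z = v.
Proof.
move=> v0; have [h|h] := leP v ps.
  exists (y v); last exact: slope_dual.
  exact: le_trans yb0 (dual_point_ge reg D1 thr dual h).
have [yb0'|yb0'] := leP yb 0.
  by have [s0 _] := slopeP yb0'; move: h; rewrite ltNge (le_trans v0 s0).
move: v0; rewrite /slope yb0' => /(cost_deriv_surj reg)[z z0 zv].
exists z => //; have pE := large_of_lt_ybar (lexx 0) yb0'.
have -> : z < yb; last by [].
by rewrite ltNge; apply/negP => /(cost_deriv_le reg yb0); rewrite zv -pE leNgt h.
Qed.

Let V z := fine (Fbar z).

Let Fbar_slope z : 0 <= z -> Fbar z = (slope z * z - value_dual u ps w (slope z))%R%:E.
Proof.
move=> z0; have [h|h] := leP yb z.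
  have [sz yz] := slopeP h; rewrite /value_dual sz -{1}yz.
  by rewrite (value_continuation r_gt0 rho_gt0 m_gt0 reg D1 thr dual sz) yz.
have pE := large_of_lt_ybar z0 h.
rewrite (value_stopping r_gt0 rho_gt0 m_gt0 reg D1 thr dual z0 (ltW h)); last first.
  by rewrite pE; apply: cost_deriv_le.
rewrite /slope h /value_dual pE leNgt (cost_deriv_decr reg z0 h)/=.
by rewrite FstarE// maximizer_cost_deriv//; congr (_%:E); ring.
Qed.

Lemma Fbar_fin z : 0 <= z -> Fbar z = (V z)%:E.
Proof. by move=> z0; rewrite /V Fbar_slope. Qed.

(** Weak duality with the costate of x, which is exact at x. *)
Let V_super x z : 0 <= x -> 0 <= z -> V z <= V x + slope x * (z - x).
Proof.
move=> x0 z0; rewrite -lee_fin -Fbar_fin//.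
apply: (le_trans (weak_duality r_gt0 rho_gt0 m_gt0 reg D1 thr dual z0 (slope_lt0 x0))).
by rewrite lee_fin {1}/V Fbar_slope//=; lra.
Qed.

Lemma Fbar_decreasing : decreasing_Rp V.
Proof. exact: supergradient_decr_decreasing V_super slope_lt0. Qed.

Lemma Fbar_strictly_concave : strictly_concave_Rp V.
Proof. exact: supergradient_decr_concave V_super slope_decr. Qed.

Lemma slope0 : slope 0 = if small then Fstar_inv u (- m) / D else F' 0.
Proof.
case: ifPn => [s|s]; last by rewrite /slope (ybar_large reg Fdm_decr Fdm_cvg s).1.
have [<- _] := threshold_small reg m_gt0 D1 Fdm_decr s.
by rewrite -[RHS](slope_dual (lexx ps)) (dual_point_ps D1 thr dual) ybar_small.
Qed.

Lemma Fbar_C1 : C1_Rp V /\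
  deriv_Rp V 0 = (if small then Fstar_inv u (- m) / D else F' 0) /\ deriv_Rp V 0 <= 0.
Proof.
have [c d] := supergradient_decr_C1 V_super slope_decr slope_surj.
by split=> //; rewrite d slope0; split=> //; rewrite -slope0 ltW// slope_lt0.
Qed.

Lemma Fbar0 : V 0 = 0.
Proof.
have [yb0'|yb0'] := leP yb 0; last first.
  have pE := large_of_lt_ybar (lexx 0) yb0'.
  rewrite /V (value_stopping r_gt0 rho_gt0 m_gt0 reg D1 thr dual (lexx 0) (ltW yb0')).
    by rewrite (cost0 reg).
  by rewrite pE; exact: cost_deriv_le.
have e : yb = 0 by apply/eqP; rewrite eq_le yb0' yb0.
have := value_continuation r_gt0 rho_gt0 m_gt0 reg D1 thr dual (lexx ps).
rewrite (dual_point_ps D1 thr dual) e /V => ->.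
by rewrite /= (dual_boundary dual) FstarE// (maximizer_ps thr) e (cost0 reg); ring.
Qed.

Lemma Fbar_ge_cost z : 0 <= z -> F z <= V z.
Proof.
move=> z0; rewrite -lee_fin -Fbar_fin//.
exact: stopping_attainment.
Qed.

(** As w >= Fstar (D .) on the continuation region, the value is at most the
    biconjugate of F at z / D, evaluated at the costate q = F' (z / D) / D; the
    hypothesis on z ensures q <= ps. *)
Lemma Fbar_le_cost z : 0 <= z -> D * phi (D * ps) <= z -> V z <= F (z / D).
Proof.
move=> z0 zD; have D0 : 0 < D by exact: lt_trans D1.
have zD0 : 0 <= z / D by rewrite divr_ge0// ltW.
pose q := F' (z / D) / D.
have DqE : D * q = F' (z / D) by rewrite /q mulrC divfK// gt_eqF.
have qp : q <= ps.
  rewrite -(ler_pM2l D0) DqE -[leRHS](maximizerP reg (ltW (Dps_lt thr))).2.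
  by apply: cost_deriv_le => //; [exact: maximizer_ge0|rewrite ler_pdivlMr// mulrC].
have := weak_duality r_gt0 rho_gt0 m_gt0 reg D1 thr dual z0 (le_lt_trans qp ps0).
rewrite Fbar_fin// lee_fin /value_dual qp.
have := dual_ge_Fstar reg D1 thr dual qp.
rewrite DqE FstarE// maximizer_cost_deriv//.
have -> : q * z = z / D * F' (z / D) by rewrite /q; ring.
by have := m_gt0; lra.
Qed.

End Value.

Theorem proposition3p5 (R : realType) (r rho m c0 c1 gamma : R) (u : R -> R)
  (r_gt0 : 0 < r) (rho_gt0 : 0 < rho) (m_gt0 : 0 < m)
  (u_ge0 : forall x, 0 <= x -> 0 <= u x)
  (u_incr : increasing_Rp u)
  (u_conc : strictly_concave_Rp u)
  (u_C2 : C2_Rp u)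
  (u_0 : u 0 = 0)
  (u'_cvg0 : deriv_Rp u x @[x --> +oo] --> 0)
  (c0_gt0 : 0 < c0) (c1_gt0 : 0 < c1) (gamma_gt1 : 1 < gamma)
  (u_growth : forall x, 0 <= x ->
    c0 * (- 1 + x `^ gamma^-1) <= u x <= c1 * (1 + x `^ gamma^-1))
  (Fdm_decr : decreasing_Rp (Fdm r rho m u))
  (Fdm_cvg : Fdm r rho m u y @[y --> +oo] --> -oo)
  (delta_gt1 : 1 < delta r rho) :
  (m <= - Fstar u (delta r rho * F' u 0) ->
    forall y, 0 <= y -> Fbar r rho m u y = wstar_conj r rho m u y) /\
  (m > - Fstar u (delta r rho * F' u 0) ->
    forall y, 0 <= y ->
      Fbar r rho m u y =
        if y <= ybar r rho m u then (F u y)%:E else wstar_conj r rho m u y) /\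
  (let Fb := fun y => fine (Fbar r rho m u y) in
   C1_Rp Fb /\
   deriv_Rp Fb 0 =
     Fstar_inv u (- m) / delta r rho
       * (m <= - Fstar u (delta r rho * F' u 0))%R%:R
     + F' u 0 * (m > - Fstar u (delta r rho * F' u 0))%R%:R /\
   deriv_Rp Fb 0 <= 0 /\
   decreasing_Rp Fb /\
   strictly_concave_Rp Fb) /\
  (exists d0 d1 : R, 0 < d0 /\ 0 < d1 /\
    forall y, 0 <= y ->
      ((d0 * (- 1 - y `^ gamma))%:E <= Fbar r rho m u y
        <= (d1 * (1 - y `^ gamma))%:E)%E).
Proof.
have u_C1 : C1_Rp u by case: u_C2.
have u_unb := u_unbounded_growth c0_gt0 gamma_gt1 u_growth.
have reg := utility_regular_cost u_incr u_conc u_C1 u_0 u'_cvg0 u_unb.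
have u_onto := u_surj u_incr u_conc u_C1 u_0 u_unb.
have Fu := F_u u_incr.
have thr := threshold_pstar reg m_gt0 delta_gt1 Fdm_decr Fdm_cvg.
have [w [y [dual wE]]] := dual_solution_exists m reg delta_gt1 (ps_lt0 thr).
have wstarw p : p <= pstar r rho m u -> wstar r rho m u p = w p.
  by move=> pp; rewrite wE// wstarE.
have stop := Fbar_stop r_gt0 rho_gt0 m_gt0 reg delta_gt1 Fdm_decr Fdm_cvg dual.
have conj := Fbar_conj r_gt0 rho_gt0 m_gt0 reg delta_gt1 Fdm_decr Fdm_cvg dual wstarw.
have fin := Fbar_fin r_gt0 rho_gt0 m_gt0 reg delta_gt1 Fdm_decr Fdm_cvg dual.
have decr := Fbar_decreasing r_gt0 rho_gt0 m_gt0 reg delta_gt1 Fdm_decr Fdm_cvg dual.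
split; [|split; [|split]].
- move=> s z z0; apply: conj.
  by rewrite (ybar_small reg (s : small_m r rho m u)).
- rewrite ltNge => s z z0; case: ifPn => [|]; first exact: stop.
  by rewrite -ltNge => /ltW; exact: conj.
- have [cC1 [d0 d0le]] := Fbar_C1 r_gt0 rho_gt0 m_gt0 reg delta_gt1 Fdm_decr Fdm_cvg dual.
  split=> //; split; last first.
    split=> //; split=> //.
    exact: (Fbar_strictly_concave r_gt0 rho_gt0 m_gt0 reg delta_gt1 Fdm_decr Fdm_cvg dual).
  rewrite d0 /small_m ltNge; case: ifPn => _.
    by rewrite mulr1 mulr0 addr0.
  by rewrite mulr1 mulr0 add0r.
have [d dpos dF] := F_growth_lower c0_gt0 gamma_gt1 u_growth u_onto Fu.
have Fup := F_growth_upper c1_gt0 gamma_gt1 u_growth u_onto Fu (cost_le0 reg).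
have D0 : 0 < delta r rho by exact: lt_trans delta_gt1.
have c2_gt0 : 0 < 2 * c1 by rewrite mulr_gt0.
have kappa0 : 0 < (delta r rho * (2 * c1))^-1 by rewrite invr_gt0 mulr_gt0.
have V0 := Fbar0 r_gt0 rho_gt0 m_gt0 reg delta_gt1 Fdm_decr Fdm_cvg dual.
have [|z z0 zY|d' d'pos dV] := power_growth_upper (lt_trans ltr01 gamma_gt1) kappa0 decr _
  (Y := delta r rho * maximizer u (delta r rho * pstar r rho m u)).
- by rewrite V0.
- apply: (le_trans (Fbar_le_cost r_gt0 rho_gt0 m_gt0 reg delta_gt1 Fdm_decr Fdm_cvg dual z0 zY)).
  rewrite (_ : _^-1 * z = z / delta r rho / (2 * c1)); last by rewrite invfM mulrC mulrA.
  by apply: Fup; rewrite divr_ge0// ltW.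
exists d, d'; split=> //; split=> // z z0; rewrite fin// !lee_fin dV// andbT.
apply: (le_trans (dF z z0)).
exact: (Fbar_ge_cost r_gt0 rho_gt0 m_gt0 reg delta_gt1 Fdm_decr Fdm_cvg dual).
Qed.
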